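(* Let $d\ge2$, $\beta>0$, $C>0$. There exist $p,q\ge1$ with $1/p+1/q=1$ and $K,\kappa>0$, all depending only on $C,\beta,d$, such that the following holds. Let $\Lambda\subset\mathbb{Z}^d$ be a finite domain with $N=|\Lambda|$, suppose $\mathrm{WSM}(C)$ holds for the RFIM on $\Lambda$ at inverse temperature $\beta$, and fix $\delta\in(0,1)$. Then with $\mathbb{P}_h$-probability at least $1-\delta$, for all $\varphi:\{-1,+1\}^\Lambda\to\mathbb{R}$, $$\mathrm{Var}_{\mu_\Lambda}(\varphi)\;\le\;K\,\delta^{-1/q}\,N^{\kappa}\,\mathcal{E}_{\mu_\Lambda}(\varphi,\varphi)^{1/p}\,\mathrm{osc}(\varphi)^{2/q}.$$
   Context: $\mathbb{Z}^d$ is viewed as a graph with nearest-neighbour adjacency; a finite $\Lambda\subset\mathbb{Z}^d$ also denotes the induced subgraph. The external field $h=(h_u)_{u\in\Lambda}$ consists of i.i.d. real random variables with a symmetric distribution; $\mathbb{P}_h,\mathbb{E}_h$ denote its law and expectation. Given $h$, the random field Ising model (RFIM) on $\Lambda$ is $$\mu_\Lambda(\sigma)\propto\exp\Big(\beta\sum_{(u,v)\in E(\Lambda)}\sigma_u\sigma_v+\sum_{u\in\Lambda}h_u\sigma_u\Big),\qquad\sigma\in\{-1,+1\}^\Lambda .$$ For $A\subseteq\Lambda$, $\partial A$ is the exterior vertex boundary of $A$ in $\Lambda$. For $\tau\in\{-1,+1\}^{\partial A}$, $\mu_A^\tau$ is the law of $\sigma_A$ under $\mu_\Lambda(\,\cdot\mid\sigma_{\partial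 A}=\tau)$; $\mu_A^{\pm}$ correspond to $\tau\equiv\pm1$. $B_r(o)$ is the $\ell_\infty$-ball of radius $r$ around $o$ in $\mathbb{Z}^d$. $d_{\mathrm{TV}}$ is total variation distance. The RFIM on $\Lambda$ satisfies $\mathrm{WSM}(C)$ if for all $o\in\Lambda$ and all $r\ge1$, $$\mathbb{E}_h\Big[d_{\mathrm{TV}}\big(\mu^{+}_{B_r(o)\cap\Lambda}(\sigma_o\in\cdot),\,\mu^{-}_{B_r(o)\cap\Lambda}(\sigma_o\in\cdot)\big)\Big]\le Ce^{-r/C}.$$ $\mathrm{Var}_\mu(\varphi)=\mu(\varphi^2)-\mu(\varphi)^2$, $\mathrm{osc}(\varphi)=\max\varphi-\min\varphi$, and $$\mathcal{E}_{\mu_\Lambda}(\varphi,\varphi)=\frac12\sum_{\sigma\sim\sigma'}\frac{\mu_\Lambda(\sigma)\mu_\Lambda(\sigma')}{\mu_\Lambda(\sigma)+\mu_\Lambda(\sigma')}(\varphi(\sigma)-\varphi(\sigma'))^2,$$ the sum being over ordered pairs $\sigma,\sigma'\in\{-1,+1\}^\Lambda$ differing in exactly one coordinate. *)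

(* Defs.v *)
From HB Require Import structures.
From mathcomp Require Import all_boot all_order all_algebra.
From mathcomp Require Import finmap.
From mathcomp Require Import all_classical all_reals all_analysis.

Set Implicit Arguments.
Unset Strict Implicit.
Unset Printing Implicit Defensive.

Import Order.TTheory GRing.Theory Num.Theory.

Local Open Scope classical_set_scope.
Local Open Scope ring_scope.

Definition lattice_adj (d : nat) (u v : 'rV[int]_d) : bool :=
  \sum_(i < d) `|u 0 i - v 0 i| == 1.

Definition box (d : nat) (L : {fset 'rV[int]_d}) (o : L) (r : nat) : {set L} :=
  [set v : L | [forall i : 'I_d, `|(val v) 0 i - (val o) 0 i| <= r%:Z]].

Definition ext_boundary (d : nat) (L : {fset 'rV[int]_d}) (A : {set L}) :
  {set L} :=
  [set v : L | (v \notin A) && [exists u in A, lattice_adj (val u) (val v)]].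

(* A spin configuration in {-1,+1}^L: [true] stands for +1, [false] for -1. *)
Definition config (d : nat) (L : {fset 'rV[int]_d}) := {ffun L -> bool}.

Definition spin (R : realType) (b : bool) : R := if b then 1 else -1.

Definition all_spins (d : nat) (L : {fset 'rV[int]_d}) (b : bool) : config L :=
  [ffun => b].

Definition differ_at_one (d : nat) (L : {fset 'rV[int]_d}) (s t : config L) :
  bool :=
  #|[pred u | s u != t u]| == 1%N.

(* The energy sums over unordered edges; the double sum meets each edge twice,
   hence the factor 1/2. *)
Definition rfim_weight (R : realType) (d : nat) (L : {fset 'rV[int]_d})
    (beta : R) (h : L -> R) (s : config L) : R :=
  expR (beta * (2^-1 * \sum_(u : L) \sum_(v : L | lattice_adj (val u) (val v))
                         spin R (s u) * spin R (s v))
        + \sum_(u : L) h u * spin R (s u)).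

Definition rfim (R : realType) (d : nat) (L : {fset 'rV[int]_d})
    (beta : R) (h : L -> R) (s : config L) : R :=
  rfim_weight beta h s / \sum_(t : config L) rfim_weight beta h t.

Definition pmf_prob (R : realType) (X : finType) (mu : X -> R) (E : {set X}) :
  R := \sum_(x in E) mu x.

Definition pmf_cond (R : realType) (X : finType) (mu : X -> R)
    (E F : {set X}) : R :=
  pmf_prob mu (E :&: F) / pmf_prob mu F.

Definition pmf_mean (R : realType) (X : finType) (mu f : X -> R) : R :=
  \sum_x mu x * f x.

Definition pmf_var (R : realType) (X : finType) (mu f : X -> R) : R :=
  pmf_mean mu (fun x => f x ^+ 2) - pmf_mean mu f ^+ 2.

Definition dTV (R : realType) (X : finType) (mu nu : X -> R) : R :=
  2^-1 * \sum_x `|mu x - nu x|.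

(* The law mu_A^tau(sigma_o \in .) of the spin at o, as a pmf on spins, for
   o \in A.  Only the values of tau on the exterior boundary of A matter. *)
Definition rfim_bc_spin (R : realType) (d : nat) (L : {fset 'rV[int]_d})
    (beta : R) (h : L -> R) (A : {set L}) (tau : config L) (o : L)
    (b : bool) : R :=
  pmf_cond (rfim beta h)
    [set s : config L | s o == b]
    [set s : config L | [forall v in ext_boundary A, s v == tau v]].

Definition osc (R : realType) (d : nat) (L : {fset 'rV[int]_d})
    (phi : config L -> R) : R :=
  \big[Num.max/phi (all_spins L true)]_(s : config L) phi s
  - \big[Num.min/phi (all_spins L true)]_(s : config L) phi s.

Definition dirichlet (R : realType) (d : nat) (L : {fset 'rV[int]_d})
    (mu phi : config L -> R) : R :=
  2^-1 * \sum_(s : config L) \sum_(t : config L | differ_at_one s t)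
           mu s * mu t / (mu s + mu t) * (phi s - phi t) ^+ 2.

Definition mutually_independent (R : realType) (disp : measure_display)
    (T : measurableType disp) (P : probability T R) (I : finType)
    (X : I -> {RV P >-> R}) : Prop :=
  forall (J : {set I}) (B : I -> set R),
    (forall i, measurable (B i)) ->
    P [set w | forall i, i \in J -> B i (X i w)] =
    (\prod_(i in J) P (X i @^-1` B i))%E.

(* nu is the common law of the field variables. *)
Definition iid_symmetric (R : realType) (disp : measure_display)
    (T : measurableType disp) (P : probability T R) (I : finType)
    (X : I -> {RV P >-> R}) : Prop :=
  mutually_independent X /\
  exists nu : probability R R,
    (forall B : set R, measurable B -> nu (-%R @^-1` B) = nu B) /\
    (forall (i : I) (B : set R), measurable B -> distribution P (X i) B = nu B).

Definition WSM (R : realType) (disp : measure_display)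
    (T : measurableType disp) (P : probability T R) (d : nat)
    (L : {fset 'rV[int]_d}) (h : L -> {RV P >-> R}) (beta C : R) : Prop :=
  forall (o : L) (r : nat), (1 <= r)%N ->
    ('E_P[fun w =>
        dTV (rfim_bc_spin beta (fun u => h u w) (box o r) (all_spins L true) o)
            (rfim_bc_spin beta (fun u => h u w) (box o r) (all_spins L false) o)]
     <= (C * expR (- (r%:R / C)))%:E)%E.

(* Main.v *)
Require Import Defs.
From HB Require Import structures.
From mathcomp Require Import all_boot all_order all_algebra.
From mathcomp Require Import finmap.
From mathcomp Require Import all_classical all_reals all_analysis.
From mathcomp Require Import measurable_realfun.
From mathcomp Require Import ring lra zify.

(** The disorder is shown to be, with probability at least [1 - delta], such that
    the RFIM satisfies a genuine Poincaré inequality [Var <= B * E] in which [B] is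
    at most a constant times [N * (N / delta) ^ A1]. Since also [Var <= osc ^ 2],
    the geometric mean of the two bounds with [p = A1 + 1] is the assertion, with
    [kappa = 1]. The Poincaré inequality comes from three ingredients.

    Block dynamics contract by attractivity. Pair an increasing function [G] of mean
    zero with the indicator of a plus spin at [u], and call the result [rho u].
    Resampling a block never increases any [rho u] (Harris' inequality,
    [ip_condE_le]), and resampling a block [b] that contains [v] makes [rho v] at
    most [eps] times the sum of [rho] over the boundary of [b], where [eps] is the
    difference at [v] between the plus and the minus boundary condition
    ([influence]). Suppose that the sites are divided into good ones, for which some
    block has [eps * #|boundary| <= theta], and bad ones, which lie in blocks bounded
    by at most [1 / (2 * theta)] good sites. Updating the blocks of the good sites
    and then those of the bad sites halves the maximum of [rho]
    ([round_contract]). Increasing functions span, and reversibility turns this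
    decay into a bound of the variance by the sum of the mean conditional variances
    in the blocks ([block_poincare]).

    Blocks reduce to sites. Deleting edges changes Ising weights by a bounded
    factor and decouples the pieces. A set [V] can be cut along a grid of mesh [g] by
    deleting of the order of [#|V| / g] edges ([exists_good_grid]), and the pieces have
    at most [g ^ d] sites; so a block costs at most the exponential of a multiple of
    [#|V| / g + g ^ d] ([condD_block]).

    The field provides the blocks. Divide the lattice into cells of side [s], and
    call a cell bad if it contains a site on which the boundary of the box of
    radius [s] has influence at least [exp (- s / (2 * C))]. By weak spatial mixing
    and Markov's inequality this has probability at most
    [s ^ d * C * exp (- s / (2 * C))], and it depends on the fields near the cell.
    Bad cells therefore form a strongly subcritical percolation: up to probability
    [N * exp (- n)] all their clusters have at most [n] cells
    ([small_clumps_prob]). Boxes serve as blocks for the good cells, clusters for the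
    bad ones; the sites next to a cluster lie in good cells. With [n = s ^ (d * d)] the
    influence, exponentially small in [s], beats the size of every boundary, which
    is polynomial in [s], and by the previous paragraph with [g = s ^ d] all blocks
    cost at most the exponential of a multiple of [n]. Choosing [n] of the order of
    [ln (N / delta)] makes this a power of [N / delta]. *)

Set Implicit Arguments.
Unset Strict Implicit.
Unset Printing Implicit Defensive.

Import Order.TTheory GRing.Theory Num.Theory.

Local Open Scope ring_scope.

(** * Configurations that agree outside a block *)

Section Agreement.
Variable V : finType.
Implicit Types (a b : {set V}) (s t : {ffun V -> bool}).

Definition agree b s t : bool := [forall u, (u \notin b) ==> (s u == t u)].

Definition mix b s t : {ffun V -> bool} :=
  [ffun u => if u \in b then s u else t u].

Lemma agreeP b s t :
  reflect (forall u, u \notin b -> s u = t u) (agree b s t).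
Proof.
apply: (iffP forallP) => [H u ub|H u]; first by apply/eqP; move/implyP: (H u); apply.
by apply/implyP => ub; rewrite H.
Qed.

Lemma agree_refl b s : agree b s s. Proof. exact/agreeP. Qed.

Lemma agree_sym b s t : agree b s t = agree b t s.
Proof. by apply/agreeP/agreeP => H u ub; rewrite H. Qed.

Lemma agree_trans b s t u : agree b s t -> agree b t u -> agree b s u.
Proof. by move=> /agreeP st /agreeP tu; apply/agreeP => x xb; rewrite st ?tu. Qed.

Lemma agree_transl b s t : agree b s t -> agree b s =1 agree b t.
Proof.
move=> st u; apply/idP/idP; last exact: agree_trans.
by apply: agree_trans; rewrite agree_sym.
Qed.

Lemma agree_subset a b s t : a \subset b -> agree a s t -> agree b s t.
Proof.
move=> /fintype.subsetP ab /agreeP st; apply/agreeP => u ub; apply: st.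
by apply: contra ub; exact: ab.
Qed.

Lemma agree_setT s t : agree [set: V] s t.
Proof. by apply/agreeP => u; rewrite inE. Qed.

Lemma agree_mix b s t : agree b (mix b s t) t.
Proof. by apply/agreeP => u ub; rewrite ffunE (negbTE ub). Qed.

Lemma agree_setU a b s t c :
  agree a s t -> agree b t c -> agree (a :|: b) s c.
Proof.
move=> st tc; apply: (@agree_trans _ _ t).
  by apply: agree_subset st; exact: finset.subsetUl.
by apply: agree_subset tc; exact: finset.subsetUr.
Qed.

(** From [s] to [c] one may change [a] first and [b] afterwards; the intermediate
    configuration is [mix b s c], so that nothing is counted twice. *)
Lemma sum_agreeU (R : nmodType) a b s (F : {ffun V -> bool} -> R) :
  [disjoint a & b] ->
  \sum_(c | agree (a :|: b) s c) F c =
  \sum_(t | agree a s t) \sum_(c | agree b t c) F c.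
Proof.
move=> dab.
rewrite (partition_big (mix b s) (agree a s)) => [|c /agreeP sc] /=; last first.
  apply/agreeP => u ua; rewrite ffunE; case: ifPn => // ub.
  by apply: sc; rewrite inE negb_or ua.
apply: eq_bigr => t /agreeP st; apply: eq_bigl => c.
apply/andP/idP => [[/agreeP sc /eqP <-]|/agreeP tc].
  by rewrite agree_sym; apply/agreeP => u ub; rewrite ffunE (negbTE ub).
have bNa u : u \in b -> u \notin a.
  by move=> ub; apply: contraL dab => ua; apply/pred0Pn; exists u; apply/andP.
split.
  by apply: agree_setU (introT (agreeP _ _ _) st) (introT (agreeP _ _ _) tc).
apply/eqP/ffunP => u; rewrite ffunE; case: ifPn => ub; last by rewrite -tc.
by apply: st; exact: bNa.
Qed.

End Agreement.

(** * Conditional expectations of a positive weight *)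

Section Conditioning.
Variables (R : realFieldType) (V : finType) (w : {ffun V -> bool} -> R).
Hypothesis w_gt0 : forall s, 0 < w s.
Implicit Types (a b : {set V}) (s t : {ffun V -> bool}) (f g : {ffun V -> bool} -> R).

(** The partition function of [b] with boundary condition [s]. *)
Definition partf b s := \sum_(t | agree b s t) w t.

(** The conditional expectation of [f] given the spins outside [b], kept as a
    function of the whole configuration. *)
Definition condE b f s := (\sum_(t | agree b s t) w t * f t) / partf b s.

Definition ip f g := \sum_s w s * (f s * g s).

(** The mean of the conditional variance of [f] given the spins outside [b],
    times the total mass of [w]. *)
Definition condD b f := \sum_s w s * (f s - condE b f s) ^+ 2.

Lemma partf_gt0 b s : 0 < partf b s.
Proof.
rewrite /partf (bigD1 s) ?agree_refl //= ltr_pwDl //.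
by apply: sumr_ge0 => t _; apply: ltW.
Qed.

Lemma partf_neq0 b s : partf b s != 0.
Proof. by rewrite gt_eqF // partf_gt0. Qed.

Lemma partf_agree b s t : agree b s t -> partf b s = partf b t.
Proof. by move=> st; apply: eq_bigl => u; exact: agree_transl. Qed.

Lemma condE_agree b f s t : agree b s t -> condE b f s = condE b f t.
Proof.
move=> st; rewrite /condE (partf_agree st); congr (_ / _).
by apply: eq_bigl => u; exact: agree_transl.
Qed.

Lemma sum_condE b f s :
  \sum_(t | agree b s t) w t * f t = partf b s * condE b f s.
Proof. by rewrite /condE mulrCA divff ?mulr1 // partf_neq0. Qed.

Lemma condE_pull b f g s : (forall t, agree b s t -> f t = f s) ->
  condE b (fun t => f t * g t) s = f s * condE b g s.
Proof.
move=> fb; rewrite /condE mulrA mulr_sumr; congr (_ / _).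
by apply: eq_bigr => t st; rewrite fb // mulrCA.
Qed.

Lemma eq_condE b f g s : (forall t, agree b s t -> f t = g t) ->
  condE b f s = condE b g s.
Proof. by move=> fg; congr (_ / _); apply: eq_bigr => t st; rewrite fg. Qed.

Lemma condE_const b f s : (forall t, agree b s t -> f t = f s) ->
  condE b f s = f s.
Proof.
move=> fb; rewrite /condE.
under eq_bigr => t st do rewrite fb //.
by rewrite -mulr_suml mulrAC divff ?mul1r // partf_neq0.
Qed.

Lemma condED b f g s : condE b (fun t => f t + g t) s = condE b f s + condE b g s.
Proof.
rewrite /condE -mulrDl -big_split; congr (_ / _).
by apply: eq_bigr => t _; rewrite mulrDr.
Qed.

Lemma condEZ b k f s : condE b (fun t => k * f t) s = k * condE b f s.
Proof. by rewrite (@condE_pull _ (fun=> k)). Qed.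

Lemma condEN b f s : condE b (fun t => - f t) s = - condE b f s.
Proof. by rewrite -mulN1r -condEZ; apply: eq_condE => t _; rewrite mulN1r. Qed.

Lemma condEB b f g s : condE b (fun t => f t - g t) s = condE b f s - condE b g s.
Proof. by rewrite condED condEN. Qed.

Lemma condE_ge0 b f s : (forall t, 0 <= f t) -> 0 <= condE b f s.
Proof.
move=> f0; apply: divr_ge0; last by rewrite ltW // partf_gt0.
by apply: sumr_ge0 => t _; rewrite mulr_ge0 // ltW.
Qed.

Lemma le_condE b f g s : (forall t, f t <= g t) -> condE b f s <= condE b g s.
Proof. by move=> fg; rewrite -subr_ge0 -condEB condE_ge0 // => t; rewrite subr_ge0. Qed.

Lemma ipC f g : ip f g = ip g f.
Proof. by apply: eq_bigr => s _; rewrite [f s * _]mulrC. Qed.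

Lemma ipDl f g k : ip (fun s => f s + g s) k = ip f k + ip g k.
Proof. by rewrite /ip -big_split; apply: eq_bigr => s _; rewrite mulrDl mulrDr. Qed.

Lemma ipZl c f k : ip (fun s => c * f s) k = c * ip f k.
Proof. by rewrite /ip mulr_sumr; apply: eq_bigr => s _; rewrite -mulrA mulrCA. Qed.

Lemma ipNl f k : ip (fun s => - f s) k = - ip f k.
Proof. by rewrite /ip -sumrN; apply: eq_bigr => s _; rewrite mulNr mulrN. Qed.

Lemma ipBl f g k : ip (fun s => f s - g s) k = ip f k - ip g k.
Proof. by rewrite ipDl ipNl. Qed.

Lemma ipDr f g k : ip k (fun s => f s + g s) = ip k f + ip k g.
Proof. by rewrite ipC ipDl !(ipC k). Qed.

Lemma ipZr c f k : ip k (fun s => c * f s) = c * ip k f.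
Proof. by rewrite ipC ipZl ipC. Qed.

Lemma eq_ipl f g k : f =1 g -> ip f k = ip g k.
Proof. by move=> fg; apply: eq_bigr => s _; rewrite fg. Qed.

Lemma eq_ipr f g k : f =1 g -> ip k f = ip k g.
Proof. by move=> fg; apply: eq_bigr => s _; rewrite fg. Qed.

Lemma ip_ge0 f : 0 <= ip f f.
Proof. by apply: sumr_ge0 => s _; rewrite -expr2 mulr_ge0 ?sqr_ge0 // ltW. Qed.

(** Reversibility of the block update. *)
Lemma condE_sa b f g : ip (condE b f) g = ip f (condE b g).
Proof.
have H f' g' : ip (condE b f') g' =
    \sum_s \sum_(t | agree b s t) (w s * w t / partf b s) * (f' t * g' s).
  apply: eq_bigr => s _; rewrite {1}/condE mulr_suml mulr_suml mulr_sumr.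
  by apply: eq_bigr => t st; ring.
rewrite H ipC H.
rewrite (exchange_big_dep predT) //=; apply: eq_bigr => s _.
rewrite (eq_bigl (fun t => agree b s t)) => [|t]; last exact: agree_sym.
by apply: eq_bigr => t st; rewrite (partf_agree st); ring.
Qed.

Lemma condE_id b f s : condE b (condE b f) s = condE b f s.
Proof.
by apply: condE_const => t st; apply: condE_agree; rewrite agree_sym.
Qed.

Lemma condDE b f : condD b f = ip f f - ip (condE b f) (condE b f).
Proof.
have -> : condD b f = ip f f - ip f (condE b f) *+ 2 + ip (condE b f) (condE b f).
  rewrite /condD /ip -sumrMnl -sumrB -big_split; apply: eq_bigr => s _ /=.
  by ring.
have -> : ip (condE b f) (condE b f) = ip f (condE b f).
  by rewrite condE_sa; apply: eq_ipr => s; exact: condE_id.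
by ring.
Qed.

Lemma condD_ge0 b f : 0 <= condD b f.
Proof. by apply: sumr_ge0 => s _; rewrite mulr_ge0 ?sqr_ge0 // ltW. Qed.

Lemma condE_contract b f : ip (condE b f) (condE b f) <= ip f f.
Proof. by rewrite -subr_ge0 -condDE condD_ge0. Qed.

(** The conditional expectation is the best approximation by a function of the
    outside spins. This variational form allows conditional variances under two
    comparable weights to be compared. *)
Lemma condD_min b f g : (forall s t, agree b s t -> g s = g t) ->
  condD b f <= \sum_s w s * (f s - g s) ^+ 2.
Proof.
move=> gb; set h := fun s => condE b f s - g s.
have -> : \sum_s w s * (f s - g s) ^+ 2 = condD b f + ip h h.
  have H : ip (fun s => f s - condE b f s) h = 0.
    have hE : h =1 condE b h.
      move=> s; rewrite condE_const // => t st.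
      by rewrite /h (gb _ _ st) (condE_agree _ st).
    rewrite (eq_ipr _ hE) -condE_sa (@eq_ipl _ (fun=> 0)) => [|s].
      by rewrite /ip big1 // => s _; rewrite mul0r mulr0.
    by rewrite condEB condE_id subrr.
  transitivity (condD b f + ip h h + ip (fun s => f s - condE b f s) h *+ 2).
    rewrite /condD /ip -sumrMnl -!big_split; apply: eq_bigr => s _ /=.
    by rewrite /h; ring.
  by rewrite H mul0rn addr0.
by rewrite lerDl ip_ge0.
Qed.

End Conditioning.

(** * Attractivity *)

Section Monotone.
Variables (R : realFieldType) (V : finType) (w : {ffun V -> bool} -> R).
Hypothesis w_gt0 : forall s, 0 < w s.
Implicit Types (a b : {set V}) (s t : {ffun V -> bool}) (f g : {ffun V -> bool} -> R).

Definition lec s t : bool := [forall u, s u ==> t u].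
Definition joinc s t : {ffun V -> bool} := [ffun u => s u || t u].
Definition meetc s t : {ffun V -> bool} := [ffun u => s u && t u].
Definition setsp x v s : {ffun V -> bool} := [ffun u => if u == x then v else s u].
Definition increasing f := forall s t, lec s t -> f s <= f t.

Hypothesis w_supermod : forall s t, w s * w t <= w (joinc s t) * w (meetc s t).

Lemma lecP s t : reflect (forall u, s u -> t u) (lec s t).
Proof. by apply: (iffP forallP) => H u; have := H u => /implyP. Qed.

Lemma lec_setsp x v s t : lec s t -> lec (setsp x v s) (setsp x v t).
Proof. by move=> /lecP st; apply/lecP => u; rewrite !ffunE; case: ifP => // _; exact: st. Qed.

Lemma lec_setsp_bool x s : lec (setsp x false s) (setsp x true s).
Proof. by apply/lecP => u; rewrite !ffunE; case: ifP. Qed.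

Lemma set_ind_U1 (P : {set V} -> Prop) :
  P finset.set0 -> (forall x b, x \notin b -> P b -> P (x |: b)) -> forall b, P b.
Proof.
move=> P0 PU b; have [n] := ubnP #|b|; elim: n b => // n IH b bn.
have [->//|/set0Pn[x xb]] := eqVneq b finset.set0.
rewrite -(finset.setD1K xb); apply: PU; first by rewrite !inE eqxx.
by apply: IH; move: bn; rewrite (cardsD1 x) xb.
Qed.

Definition odds x s := w (setsp x true s) / w (setsp x false s).

(** Ferromagnetism enters here: join and meet exchange the values at [x] of
    two ordered configurations. *)
Lemma odds_increasing x : increasing (odds x).
Proof.
move=> s t /lecP st; rewrite /odds ler_pdivrMr // mulrAC ler_pdivlMr //.
have := w_supermod (setsp x true s) (setsp x false t).
have -> : joinc (setsp x true s) (setsp x false t) = setsp x true t.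
  by apply/ffunP => u; rewrite !ffunE; case: ifP => // _; have := st u; case: (s u) => // ->.
have -> // : meetc (setsp x true s) (setsp x false t) = setsp x false s.
apply/ffunP => u; rewrite !ffunE; case: ifP => // _.
by have := st u; case: (s u) => // ->.
Qed.

Lemma sum_agree1 x s (F : {ffun V -> bool} -> R) :
  \sum_(t | agree [set x] s t) F t = F (setsp x true s) + F (setsp x false s).
Proof.
rewrite (reindex_onto (fun v => setsp x v s) (fun t => t x)) => [|t /agreeP st] /=.
  rewrite (eq_bigl predT) ?big_bool // => v; rewrite ffunE eqxx eqxx andbT.
  by apply/agreeP => u; rewrite inE ffunE => /negbTE ->.
by apply/ffunP => u; rewrite ffunE; case: eqP => [->//|/eqP ux]; rewrite st // inE.
Qed.

Lemma agree_setsp x v b s t : agree b s t -> agree b (setsp x v s) (setsp x v t).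
Proof. by move=> /agreeP st; apply/agreeP => u ub; rewrite !ffunE st. Qed.

(** Turning the boundary spin [x] up multiplies each weight of the block by the
    odds of [x], hence the partition function by their mean. *)
Lemma partf_setsp x b s : x \notin b ->
  partf w b (setsp x true s) =
  partf w b (setsp x false s) * condE w b (odds x) (setsp x false s).
Proof.
move=> xb; rewrite -sum_condE // /partf.
rewrite (reindex_onto (setsp x true) (setsp x false)) /=; last first.
  move=> c /agreeP sc; apply/ffunP => u; rewrite !ffunE; case: eqP => // ->.
  by rewrite -sc // !ffunE eqxx.
apply: eq_big => [c|c /andP[sc /eqP cE]]; last first.
  have cm : setsp x false c = c.
    by rewrite -cE; apply/ffunP => u; rewrite !ffunE; case: eqP.
  by rewrite /odds cm mulrCA divff ?mulr1 // gt_eqF.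
apply/andP/idP => [[sc /eqP <-]|sc].
  have /agreeP H := agree_setsp x false sc; apply/agreeP => u ub.
  by have := H u ub; rewrite !ffunE; case: eqP.
split.
  have /agreeP H := agree_setsp x true sc; apply/agreeP => u ub.
  by have := H u ub; rewrite !ffunE; case: eqP.
apply/eqP/ffunP => u; rewrite !ffunE; case: eqP => // ->.
by move/agreeP: sc => <- //; rewrite ffunE eqxx.
Qed.

(** Adding the site [x] to the resampled block averages the two conditional
    expectations with odds that are themselves a conditional expectation of an
    increasing function: this makes block-wise statements amenable to induction
    on the block. *)
Lemma condE_setU1 x b f s : x \notin b ->
  let q := condE w b (odds x) (setsp x false s) in
  condE w (x |: b) f s =
  (q * condE w b f (setsp x true s) + condE w b f (setsp x false s)) / (q + 1).
Proof.
move=> xb q.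
have dxb : [disjoint [set x] & b] by rewrite disjoints1.
have Zm := partf_neq0 w_gt0 b (setsp x false s).
have q0 : 0 < q + 1.
  apply: ltr_wpDl => //; apply: condE_ge0 => // t.
  by rewrite divr_ge0 ?ltW.
rewrite {1}/condE /partf !sum_agreeU // !sum_agree1 !sum_condE //.
rewrite -!/(partf _ _ _) partf_setsp // -/q; field.
by rewrite -{2}[partf _ _ _]mulr1 -mulrDr mulf_neq0 ?gt_eqF // partf_gt0.
Qed.

Lemma odds_ge0 x b s : 0 <= condE w b (odds x) s.
Proof. by apply: condE_ge0 => // t; rewrite divr_ge0 ?ltW. Qed.

Lemma condE_set0 f s : condE w finset.set0 f s = f s.
Proof.
apply: condE_const => // t /agreeP st; congr f; apply/ffunP => u.
by rewrite st // inE.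
Qed.

(** With more plus spins outside, the odds grow by induction, and so do the two
    averages between which they interpolate. *)
Lemma condE_increasing b f : increasing f -> increasing (condE w b f).
Proof.
elim/set_ind_U1: b f => [|x b xb IH] f fi s t st.
  by rewrite !condE_set0; exact: fi.
rewrite !condE_setU1 //.
set q := condE _ _ _ _; set q' := condE _ _ (odds x) (setsp x false t).
have qq' : q <= q' by apply: IH; [exact: odds_increasing|exact: lec_setsp].
have q0 : 0 <= q by exact: odds_ge0.
clearbody q q'.
have A : condE w b f (setsp x true s) <= condE w b f (setsp x true t).
  by apply: IH => //; exact: lec_setsp.
have B : condE w b f (setsp x false s) <= condE w b f (setsp x false t).
  by apply: IH => //; exact: lec_setsp.
have C : condE w b f (setsp x false t) <= condE w b f (setsp x true t).
  by apply: IH => //; exact: lec_setsp_bool.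
move: (condE w b f (setsp x true s)) (condE w b f (setsp x true t))
  (condE w b f (setsp x false s)) (condE w b f (setsp x false t)) A B C.
move=> Fp Fp' Fm Fm' A B C.
apply: (@le_trans _ _ ((q * Fp' + Fm') / (q + 1))).
  rewrite ler_pM2r ?invr_gt0; last lra.
  by rewrite lerD // ler_wpM2l.
rewrite ler_pdivrMr ?[_ / _ * _]mulrAC ?ler_pdivlMr; try lra.
have : 0 <= (q' - q) * (Fp' - Fm') by rewrite mulr_ge0 ?subr_ge0.
by lra.
Qed.

(** Harris' inequality for the conditional measures: by induction on the block,
    the covariance splits into an average of smaller covariances and the
    covariance of two increasing functions of a single spin. *)
Lemma harris b f g s : increasing f -> increasing g ->
  condE w b f s * condE w b g s <= condE w b (fun t => f t * g t) s.
Proof.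
move=> fi gi; elim/set_ind_U1: b s => [|x b xb IH] s.
  by rewrite !condE_set0.
rewrite !condE_setU1 //.
set q := condE _ _ (odds x) _.
have q0 : 0 <= q by exact: odds_ge0.
clearbody q.
have A := @condE_increasing b _ fi _ _ (lec_setsp_bool x s).
have B := @condE_increasing b _ gi _ _ (lec_setsp_bool x s).
have := IH (setsp x true s); have := IH (setsp x false s).
move: (condE w b (fun t => f t * g t) (setsp x true s))
  (condE w b (fun t => f t * g t) (setsp x false s)).
move: (condE w b f (setsp x true s)) (condE w b f (setsp x false s))
  (condE w b g (setsp x true s)) (condE w b g (setsp x false s)) A B.
move=> Fp Fm Gp Gm A B Hp Hm Cm Cp.
have q1 : 0 < q + 1 by lra.
rewrite mulf_div ler_pdivrMr ?mulr_gt0 // mulrAC ler_pdivlMr //.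
have : 0 <= q * (Fp - Fm) * (Gp - Gm) by rewrite !mulr_ge0 ?subr_ge0.
have : 0 <= (Hm - Fm * Gm) * (q + 1) ^+ 2 by rewrite mulr_ge0 ?subr_ge0 ?sqr_ge0.
have : 0 <= q * (Hp - Fp * Gp) * (q + 1) ^+ 2.
  by rewrite mulr_ge0 ?sqr_ge0 // mulr_ge0 // subr_ge0.
move=> X Y Z.
have := addr_ge0 (addr_ge0 X Y) (mulr_ge0 Z (ltW q1)).
by lra.
Qed.

Lemma condE_ip1 b f : ip w (condE w b f) (fun=> 1) = ip w f (fun=> 1).
Proof. by rewrite condE_sa //; apply: eq_ipr => s; rewrite condE_const. Qed.

(** Updating the density [g] cannot increase the mean of an increasing [f]:
    by reversibility this is Harris' inequality in each class. *)
Lemma ip_condE_le b f g : increasing f -> increasing g ->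
  ip w g (condE w b f) <= ip w g f.
Proof.
move=> fi gi.
have -> : ip w g (condE w b f) = ip w (condE w b g) (condE w b f).
  by rewrite condE_sa //; apply: eq_ipr => s; rewrite condE_id.
have -> : ip w g f = \sum_s w s * condE w b (fun t => g t * f t) s.
  transitivity (ip w (fun t => g t * f t) (fun=> 1)).
    by apply: eq_bigr => s _; rewrite mulr1.
  by rewrite -(condE_ip1 b); apply: eq_bigr => s _; rewrite mulr1.
by apply: ler_sum => s _; rewrite ler_pM2l // harris.
Qed.

(** Positive association of the whole measure, seen as the update of all sites. *)
Lemma ip_increasing_ge0 f g : increasing f -> increasing g ->
  ip w g (fun=> 1) = 0 -> 0 <= ip w g f.
Proof.
move=> fi gi g0; apply: le_trans (ip_condE_le [set: V] fi gi).
pose s0 : {ffun V -> bool} := [ffun=> true].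
have -> : ip w g (condE w [set: V] f) = condE w [set: V] f s0 * ip w g (fun=> 1).
  rewrite [RHS]mulrC /ip mulr_suml; apply: eq_bigr => s _.
  by rewrite (condE_agree w f (agree_setT s s0)) mulr1 mulrA.
by rewrite g0 mulr0.
Qed.

Definition plus_at (u : V) s : R := (s u)%:R.

Lemma plus_at_increasing u : increasing (plus_at u).
Proof. by move=> s t /lecP st; rewrite ler_nat; have := st u; case: (s u) => // ->. Qed.

(** A function that depends on the spins of [bd] only and oscillates by at most
    [eps] is dominated, in the order of increasing functions, by [eps] times the
    number of plus spins in [bd]. *)
Lemma influence (bd : {set V}) (eps : R) f g :
  0 <= eps ->
  (forall s t, (forall u, u \in bd -> s u = t u) -> f s = f t) ->
  (forall s t, f s - f t <= eps) ->
  increasing g -> ip w g (fun=> 1) = 0 ->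
  ip w g f <= eps * \sum_(u in bd) ip w g (plus_at u).
Proof.
move=> e0 fbd feps gi g0.
pose k s := eps * (\sum_(u in bd) plus_at u s) - f s.
have ki : increasing k.
  move=> s t st; rewrite /k.
  have [/forall_inP H|] := boolP [forall u in bd, s u == t u].
    rewrite (fbd s t) => [|u ub]; last by apply/eqP/H.
    rewrite lerD2r ler_wpM2l //; apply: ler_sum => u _.
    exact: plus_at_increasing.
  rewrite negb_forall => /existsP[u]; rewrite negb_imply => /andP[ub sut].
  have H : 1 + \sum_(u in bd) plus_at u s <= \sum_(u in bd) plus_at u t.
    rewrite [X in 1 + X](bigD1 u ub) [X in _ <= X](bigD1 u ub) /=.
    rewrite addrA lerD //; last by apply: ler_sum => v _; exact: plus_at_increasing.
    move: st sut => /lecP /(_ u); rewrite /plus_at.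
    by case: (s u) (t u) => [] [] //= H _; rewrite ?addr0 //; have := H isT.
  have := feps t s; have := ler_wpM2l e0 H; rewrite mulrDr mulr1; lra.
have := ip_increasing_ge0 ki gi g0.
rewrite ipC ipBl ipZl [ip w f g]ipC subr_ge0 => /le_trans -> //.
rewrite ler_wpM2l //.
have -> // : ip w (fun s => \sum_(u in bd) plus_at u s) g = \sum_(u in bd) ip w g (plus_at u).
rewrite /ip exchange_big; apply: eq_bigr => s _ /=.
by rewrite mulr_suml mulr_sumr; apply: eq_bigr => u _; rewrite [plus_at u s * _]mulrC.
Qed.

End Monotone.

(** * Contraction of block updates and the block Poincaré inequality *)

Section Sweeps.
Variables (R : realType) (V : finType) (w : {ffun V -> bool} -> R).
Hypothesis w_gt0 : forall s, 0 < w s.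
Hypothesis w_supermod : forall s t, w s * w t <= w (joinc s t) * w (meetc s t).
Variables (blk : V -> {set V}).
Implicit Types (l : seq V) (s t : {ffun V -> bool}) (f g : {ffun V -> bool} -> R).
Local Notation E v := (condE w (blk v)).
Local Notation "'⟪' f , g '⟫'" := (ip w f g) (format "'⟪' f ,  g '⟫'").
Local Notation one := (fun=> 1).
Local Notation up := (@plus_at R V).
Local Notation increasing := (@increasing R V).

Definition sweep l g := foldl (fun g v => E v g) g l.

Lemma sweep_cat l1 l2 g : sweep (l1 ++ l2) g = sweep l2 (sweep l1 g).
Proof. exact: foldl_cat. Qed.

Lemma sweep_rcons l v g : sweep (rcons l v) g = E v (sweep l g).
Proof. by rewrite -cats1 sweep_cat. Qed.

Lemma eq_condE1 b f g : f =1 g -> condE w b f =1 condE w b g.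
Proof. by move=> fg s; apply: eq_condE => t _. Qed.

Lemma eq_sweep l f g : f =1 g -> sweep l f =1 sweep l g.
Proof. by elim: l f g => // v l IH f g fg; apply: IH; exact: eq_condE1. Qed.

Lemma sweep_linear l f g c s :
  sweep l (fun s => f s + c * g s) s = sweep l f s + c * sweep l g s.
Proof.
elim: l f g s => // v l IH f g s; rewrite /= -IH.
by apply: eq_sweep => t; rewrite condED condEZ.
Qed.

Lemma sweep_sa l f g : ⟪sweep l f, g⟫ = ⟪f, sweep (rev l) g⟫.
Proof.
elim: l f g => // v l IH f g.
by rewrite rev_cons sweep_rcons -condE_sa // -IH.
Qed.

Lemma sweep_contract l g : ⟪sweep l g, sweep l g⟫ <= ⟪g, g⟫.
Proof.
elim/last_ind: l => // l v IH; rewrite sweep_rcons.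
by apply: le_trans IH; exact: condE_contract.
Qed.

(** The mean-zero increasing functions: the cone that sweeps preserve, and on
    which pairing with the spin indicators decreases along a sweep. *)
Definition inc0 g := increasing g /\ ⟪g, one⟫ = 0.

Lemma inc0_sweep l g : inc0 g -> inc0 (sweep l g).
Proof.
elim: l g => // v l IH g [gi g0]; apply: IH; split.
  exact: condE_increasing.
by rewrite condE_ip1.
Qed.

Lemma up_ge0 g v : inc0 g -> 0 <= ⟪g, up v⟫.
Proof. by move=> [gi g0]; apply: ip_increasing_ge0 => //; exact: plus_at_increasing. Qed.

Lemma sweep_up_le l g v : inc0 g -> ⟪sweep l g, up v⟫ <= ⟪g, up v⟫.
Proof.
elim: l g => // u l IH g gi; apply: le_trans (IH _ _) _.
  exact: (inc0_sweep [:: u]).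
by rewrite condE_sa //; apply: ip_condE_le => //; [exact: plus_at_increasing|case: gi].
Qed.

Section Contraction.
Variables (good : {set V}) (bd : V -> {set V}) (eps : V -> R) (theta : R).
Hypothesis theta_ge0 : 0 <= theta.
Hypothesis theta_half : theta <= 2^-1.
Hypothesis bd_loc : forall v s t, (forall u, u \in bd v -> s u = t u) ->
  E v (up v) s = E v (up v) t.
Hypothesis good_eps_ge0 : forall v, v \in good -> 0 <= eps v.
Hypothesis good_osc : forall v s t, v \in good -> E v (up v) s - E v (up v) t <= eps v.
Hypothesis good_bd : forall v, v \in good -> eps v * #|bd v|%:R <= theta.
Hypothesis bad_bd : forall v, v \notin good -> bd v \subset good.
Hypothesis bad_card : forall v, v \notin good -> theta * #|bd v|%:R <= 2^-1.

(** At the moment when [v] is updated its pairing falls to at most [e] times the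
    pairings on the boundary of its block, which have not increased before; and
    it does not increase afterwards. *)
Lemma sweep_hit l g v (e M : R) : 0 <= e -> 0 <= M -> inc0 g -> v \in l ->
  (forall s t, E v (up v) s - E v (up v) t <= e) ->
  (forall u, u \in bd v -> ⟪g, up u⟫ <= M) ->
  ⟪sweep l g, up v⟫ <= e * #|bd v|%:R * M.
Proof.
move=> e0 M0 gi /path.splitPr[p q] He HM.
rewrite sweep_cat /=; set g' := sweep p g.
have g'i : inc0 g' by exact: inc0_sweep.
apply: le_trans (sweep_up_le _ _ (inc0_sweep [:: v] g'i)) _.
rewrite /= condE_sa //.
apply: le_trans (@influence _ _ _ w_gt0 w_supermod (bd v) e _ _ e0 _ He g'i.1 g'i.2) _.
  by move=> s t; exact: bd_loc.
rewrite -mulrA ler_wpM2l // mulr_natl -sumr_const; apply: ler_sum => u ub.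
by apply: le_trans (sweep_up_le _ _ gi) _; exact: HM.
Qed.

Definition round : seq V := enum good ++ enum (~: good).

Lemma condE_up_osc v s t : E v (up v) s - E v (up v) t <= 1.
Proof.
rewrite lerBlDr -[leLHS]addr0; apply: lerD.
  rewrite -[leRHS](@condE_const _ _ w w_gt0 (blk v) (fun=> 1) s) //.
  by apply: le_condE => // c; rewrite /plus_at; case: (c v).
by apply: condE_ge0 => // c; rewrite ler0n.
Qed.

(** Good sites come first: after their updates all of them carry at most
    [theta * M]. A bad site then collects at most the sum over its boundary, which
    consists of good sites, and [theta] beats the size of that boundary. *)
Lemma round_contract g M : 0 <= M -> inc0 g -> (forall v, ⟪g, up v⟫ <= M) ->
  forall v, ⟪sweep round g, up v⟫ <= 2^-1 * M.
Proof.
move=> M0 gi gM; rewrite /round sweep_cat.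
set g1 := sweep (enum good) g.
have g1i : inc0 g1 by exact: inc0_sweep.
have g1M v : v \in good -> ⟪g1, up v⟫ <= theta * M.
  move=> vg; apply: le_trans (@sweep_hit _ _ v (eps v) M _ _ _ _ _ _) _ => //.
  - exact: good_eps_ge0.
  - by rewrite mem_enum.
  - by move=> s t; exact: good_osc.
  - by rewrite ler_wpM2r // good_bd.
move=> v; have [vg|vb] := boolP (v \in good).
  apply: le_trans (sweep_up_le _ _ g1i) _; apply: le_trans (g1M _ vg) _.
  by rewrite ler_wpM2r.
apply: le_trans (@sweep_hit _ _ v 1 (theta * M) _ _ _ _ _ _) _ => //.
- exact: mulr_ge0.
- by rewrite mem_enum inE.
- by move=> s t; exact: condE_up_osc.
- by move=> u ub; apply: g1M; have /fintype.subsetP := bad_bd vb; exact.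
- by rewrite mul1r mulrA ler_wpM2r // mulrC bad_card.
Qed.

(** Followed by its reverse, a round becomes a self-adjoint operator. *)
Definition palin : seq V := round ++ rev round.
Definition psweep := sweep palin.

Lemma psweep_sa f g : ⟪psweep f, g⟫ = ⟪f, psweep g⟫.
Proof. by rewrite sweep_sa /palin rev_cat revK. Qed.

Lemma iter_psweep_sa k f g : ⟪iter k psweep f, g⟫ = ⟪f, iter k psweep g⟫.
Proof.
elim: k f g => // k IH f g; rewrite iterS psweep_sa IH.
by rewrite -[in RHS]addn1 iterD.
Qed.

Lemma iter_psweep_contract k g M : 0 <= M -> inc0 g -> (forall v, ⟪g, up v⟫ <= M) ->
  inc0 (iter k psweep g) /\ forall v, ⟪iter k psweep g, up v⟫ <= M / 2 ^+ k.
Proof.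
move=> M0 gi gM; elim: k => [|k [IHi IH]]; first by rewrite expr0 divr1.
split; first exact: inc0_sweep.
move=> v; rewrite iterS /psweep /palin sweep_cat.
apply: le_trans (sweep_up_le _ _ (inc0_sweep round IHi)) _.
rewrite exprS invfM mulrCA; apply: round_contract => //.
by rewrite divr_ge0 // exprn_ge0.
Qed.

Lemma eq_iter_psweep k f g : f =1 g -> iter k psweep f =1 iter k psweep g.
Proof. by move=> fg; elim: k => // k IH; exact: eq_sweep. Qed.

Lemma iter_psweep_linear k f g c s :
  iter k psweep (fun s => f s + c * g s) s = iter k psweep f s + c * iter k psweep g s.
Proof.
elim: k s => // k IH s; rewrite !iterS -sweep_linear.
exact: eq_sweep.
Qed.

Lemma ip_abs_le f g (c : R) : inc0 g -> 0 <= c ->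
  (forall s t, f s - f t <= c) -> `|⟪g, f⟫| <= c * \sum_v ⟪g, up v⟫.
Proof.
move=> [gi g0] c0 fc; rewrite ler_norml; apply/andP; split.
  rewrite lerNl -[leLHS]mulN1r.
  have -> : -1 * ⟪g, f⟫ = ⟪g, (fun s => - f s)⟫ by rewrite mulN1r [RHS]ipC ipNl ipC.
  apply: le_trans (@influence _ _ _ w_gt0 w_supermod [set: V] c _ _ c0 _ _ gi g0) _.
  - by move=> s t st; congr (- f _); apply/ffunP => u; apply: st.
  - by move=> s t; have := fc t s; lra.
  - by rewrite (eq_bigl predT) // => u; rewrite inE.
apply: le_trans (@influence _ _ _ w_gt0 w_supermod [set: V] c _ _ c0 _ _ gi g0) _.
- by move=> s t st; congr f; apply/ffunP => u; apply: st.
- exact: fc.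
- by rewrite (eq_bigl predT) // => u; rewrite inE.
Qed.

Lemma exists_osc_bound f : exists2 c : R, 0 <= c & forall s t, f s - f t <= c.
Proof.
pose c : R := (\sum_s `|f s|) *+ 2.
have fle s : `|f s| <= \sum_s `|f s| by rewrite (bigD1 s) //= lerDl sumr_ge0.
exists c => [|s t]; first by rewrite mulrn_wge0 // sumr_ge0.
have := fle s; have := fle t; rewrite /c mulr2n !ler_norml; lra.
Qed.

(** Adding a large multiple of the number of plus spins makes any function
    increasing, so the mean-zero increasing functions span. *)
Lemma exists_inc0_decomp f : ⟪f, one⟫ = 0 ->
  exists g1 g2 : {ffun V -> bool} -> R, [/\ inc0 g1, inc0 g2 & forall s, f s = g1 s - g2 s].
Proof.
move=> f0.
have [c c0 fc] := exists_osc_bound f.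
pose N s := c * \sum_v up v s.
have one_gt0 : 0 < ⟪one, one⟫.
  rewrite /ip (bigD1 [ffun=> true]) //= ltr_pwDl ?mulr1 //.
  by apply: sumr_ge0 => s _; rewrite !mulr1 ltW.
pose m := ⟪N, one⟫ / ⟪one, one⟫.
have Ni : increasing N.
  move=> s t st; rewrite ler_wpM2l //; apply: ler_sum => v _.
  exact: plus_at_increasing.
have m0 g : ⟪g, one⟫ = ⟪N, one⟫ -> ⟪(fun s => g s - m * 1), one⟫ = 0.
  by move=> gN; rewrite ipBl ipZl /m gN -mulrA mulVf ?mulr1 ?subrr // gt_eqF.
exists (fun s => (N s + f s) - m * 1), (fun s => N s - m * 1); split.
- split; last by apply: m0; rewrite ipDl f0 addr0.
  move=> s t st; rewrite lerD2r.
  have [->//|snt] := eqVneq s t.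
  have [u su] : exists u, s u != t u.
    apply/existsP; rewrite -negb_forall; apply: contra snt => /forallP H.
    by apply/eqP/ffunP => u; apply/eqP/H.
  have : 1 + \sum_u up u s <= \sum_u up u t.
    rewrite (bigD1 u) //= [leRHS](bigD1 u) //= addrA lerD //; last first.
      by apply: ler_sum => v _; exact: plus_at_increasing.
    move: st su => /lecP /(_ u); rewrite /plus_at.
    by case: (s u) (t u) => [] [] //= H _; rewrite ?addr0 //; have := H isT.
  move/(ler_wpM2l c0); rewrite mulrDr mulr1 /N.
  by have := fc s t; lra.
- split; last exact: m0.
  by move=> s t st; rewrite lerD2r; exact: Ni.
- by move=> s; ring.
Qed.

(** Pairings with an arbitrary [f] are controlled by the pairings with spin
    indicators ([ip_abs_le]), which each round halves. *)
Lemma iter_psweep_decay f : ⟪f, one⟫ = 0 ->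
  exists M : R, forall k, ⟪iter k psweep f, f⟫ <= M / 2 ^+ k.
Proof.
move=> f0; have [g1 [g2 [g1i g2i fE]]] := exists_inc0_decomp f0.
have [c c0 fc] := exists_osc_bound f.
have bnd g : inc0 g -> exists M : R, forall k, `|⟪iter k psweep g, f⟫| <= M / 2 ^+ k.
  move=> gi; pose M0 := \sum_v ⟪g, up v⟫.
  have M00 : 0 <= M0 by apply: sumr_ge0 => v _; exact: up_ge0.
  exists (c * (M0 *+ #|V|)) => k.
  have [|ki kM] := @iter_psweep_contract k g M0 M00 gi.
    by move=> v; rewrite /M0 (bigD1 v) //= lerDl sumr_ge0 // => u _; exact: up_ge0.
  apply: le_trans (ip_abs_le ki c0 fc) _; rewrite -mulrA ler_wpM2l //.
  apply: le_trans (ler_sum _ (fun v _ => kM v)) _.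
  by rewrite sumr_const mulrnAl.
have [M1 H1] := bnd _ g1i; have [M2 H2] := bnd _ g2i.
exists (M1 + M2) => k.
have -> : ⟪iter k psweep f, f⟫ = ⟪iter k psweep g1, f⟫ - ⟪iter k psweep g2, f⟫.
  rewrite -mulN1r -ipZl -ipDl; apply: eq_ipl => s.
  rewrite -iter_psweep_linear; apply: eq_iter_psweep => t.
  by rewrite fE mulN1r.
rewrite mulrDl lerD //; first exact: le_trans (ler_norm _) (H1 k).
by apply: le_trans (H2 k); rewrite -normrN ler_norm.
Qed.

Lemma ip_cs f g : ⟪f, g⟫ ^+ 2 <= ⟪f, f⟫ * ⟪g, g⟫.
Proof.
have [g0|g0] := eqVneq ⟪g, g⟫ 0.
  have gz s : g s = 0.
    have := g0 => /eqP; rewrite /ip psumr_eq0 => [/allP|t _]; last first.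
      by rewrite -expr2 mulr_ge0 ?sqr_ge0 // ltW.
    move=> /(_ s (mem_index_enum _)) /=; rewrite mulf_eq0 gt_eqF //= -expr2.
    by rewrite sqrf_eq0 => /eqP.
  rewrite g0 mulr0 (_ : ⟪f, g⟫ = 0) ?expr0n //.
  by apply: big1 => s _; rewrite gz !mulr0.
have gp : 0 < ⟪g, g⟫ by rewrite lt_def g0 ip_ge0.
have := ip_ge0 w_gt0 (fun s => ⟪g, g⟫ * f s + - ⟪f, g⟫ * g s).
rewrite ipDl !ipDr !ipZl !ipZr [⟪g, f⟫]ipC.
set A := ⟪f, f⟫; set B := ⟪f, g⟫; set C := ⟪g, g⟫ => H.
rewrite -(ler_pM2l gp) -/C -subr_ge0.
by apply: le_trans H _; rewrite le_eqVlt; apply/orP; left; apply/eqP; ring.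
Qed.

(** Reversibility upgrades the decay of the pairings [⟪iter k psweep f, f⟫] to a
    contraction of one palindromic round: the ratios of [4 ^ k] times the squared
    norm of [iter k psweep f] to that of [f] at least square themselves when [k]
    doubles, so that they could not stay bounded if the first exceeded [1]. *)
Lemma psweep_contract f : ⟪f, one⟫ = 0 -> 4 * ⟪psweep f, psweep f⟫ <= ⟪f, f⟫.
Proof.
move=> f0; have [M HM] := iter_psweep_decay f0.
(* The normalization cancels the expected decay, so [y] is bounded. *)
pose y k := 4 ^+ k * ⟪iter k psweep f, iter k psweep f⟫.
have yM k : y k <= M.
  rewrite /y iter_psweep_sa -iterD ipC addnn.
  have -> : 4 ^+ k = 2 ^+ k.*2 :> R by rewrite -mul2n exprM -[4]/(2 * 2)%:R natrM.
  rewrite mulrC -ler_pdivlMr ?exprn_gt0 //; exact: HM.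
have ysq k : y k ^+ 2 <= y k.*2 * ⟪f, f⟫.
  rewrite /y exprMn iter_psweep_sa -iterD ipC -exprM muln2 -mulrA ler_pM2l ?exprn_gt0 //.
  by rewrite addnn; exact: ip_cs.
rewrite -[X in X <= _]/(y 1%N); rewrite leNgt; apply/negP => H.
have [a0|a0] := eqVneq ⟪f, f⟫ 0.
  move: H; rewrite a0 ltNge /y expr1 pmulr_rle0 //.
  by apply/negP; rewrite negbK -a0; exact: sweep_contract.
have ap : 0 < ⟪f, f⟫ by rewrite lt_def a0 ip_ge0.
set a := ⟪f, f⟫ in H ysq ap.
pose e := y 1%N / a - 1.
have ep : 0 < e by rewrite subr_gt0 ltr_pdivlMr // mul1r.
have grow j : (1 + e *+ 2 ^ j) * a <= y (2 ^ j)%N.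
  elim: j => [|j IH].
    by rewrite expn0 mulr1n addrC subrK divfK // gt_eqF.
  rewrite expnS mul2n -(ler_pM2r ap); apply: le_trans (ysq _).
  have := IH; have e0 : 0 <= e *+ 2 ^ j by rewrite mulrn_wge0 // ltW.
  have -> : e *+ (2 ^ j).*2 = e *+ 2 ^ j + e *+ 2 ^ j by rewrite -addnn mulrnDr.
  move: (e *+ 2 ^ j) e0 (y (2 ^ j)%N) => x x0 z xz.
  have z0 : 0 <= (1 + x) * a by rewrite mulr_ge0 ?ltW //; lra.
  apply: (@le_trans _ _ (((1 + x) * a) ^+ 2)); last by rewrite ler_sqr ?nnegrE // (le_trans z0).
  have : 0 <= (x * a) ^+ 2 by rewrite sqr_ge0.
  lra.
have ea : 0 < e * a by rewrite mulr_gt0.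
have M0 : 0 <= M / (e * a).
  by rewrite divr_ge0 ?ltW //; exact: lt_le_trans (lt_trans ap H) (yM 1%N).
have := archi_boundP M0; set n := Num.bound _ => Mn.
have := le_trans (grow n) (yM _); apply/negP; rewrite -ltNge.
move: Mn; rewrite ltr_pdivrMr // => /lt_le_trans -> //.
apply: (@le_trans _ _ ((2 ^ n)%:R * (e * a))).
  by rewrite ler_pM2r // ler_nat ltnW // ltn_expl.
by rewrite mulrA mulr_natl ler_pM2r // lerDr.
Qed.

(** Each update moves orthogonally to the range in which the later distance to
    [f] is measured, so that the squared distances add up without loss. *)
Lemma sweep_dist l f :
  let h := fun s => f s - sweep l f s in
  ⟪h, h⟫ <= \sum_(v <- l) condD w (blk v) f.
Proof.
elim/last_ind: l => [|l v IH] /=.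
  by rewrite big_nil /ip big1 // => s _; rewrite /= subrr mulr0 mulr0.
set h := fun s => f s - sweep l f s in IH.
rewrite -cats1 big_cat big_seq1 cats1 /= addrC.
pose k s := f s - E v f s.
have hE s : f s - sweep (rcons l v) f s = k s + E v h s.
  by rewrite sweep_rcons /k /h condEB; ring.
have kh : ⟪k, E v h⟫ = 0.
  rewrite -condE_sa // (@eq_ipl _ _ _ _ (fun=> 0)) => [|s].
    by apply: big1 => s _; rewrite mul0r mulr0.
  by rewrite /k condEB condE_id // subrr.
have kk : condD w (blk v) f = ⟪k, k⟫ by apply: eq_bigr => s _; rewrite expr2.
rewrite kk; clearbody k; rewrite (eq_ipl _ _ hE) (eq_ipr _ _ hE) ipDl !ipDr.
rewrite [⟪E v h, k⟫]ipC kh addr0 add0r lerD2l.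
exact: le_trans (condE_contract _ _ _) IH.
Qed.

(** Since [psweep] halves norms, [f] is at distance at least half its norm from
    [psweep f], and that distance is paid for by the block variances. *)
Theorem block_poincare f : ⟪f, one⟫ = 0 -> ⟪f, f⟫ <= 8 * \sum_v condD w (blk v) f.
Proof.
move=> f0.
have H4 := psweep_contract f0.
have := sweep_dist palin f; set h := fun s => f s - _ => /= Hh.
have Dsum : \sum_(v <- palin) condD w (blk v) f = (\sum_v condD w (blk v) f) *+ 2.
  rewrite /palin big_cat big_rev /= -mulr2n; congr (_ *+ 2).
  rewrite /round big_cat /= !big_enum /= [RHS](bigID (mem good)) /=.
  by congr (_ + _); apply: eq_bigl => v; rewrite inE.
rewrite Dsum in Hh.
have hE : ⟪h, h⟫ = ⟪f, f⟫ - ⟪f, psweep f⟫ *+ 2 + ⟪psweep f, psweep f⟫.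
  by rewrite /h /ip -sumrMnl -sumrB -big_split; apply: eq_bigr => s _ /=; rewrite /psweep; ring.
have a0 := ip_ge0 w_gt0 f; have b0 := ip_ge0 w_gt0 (psweep f).
have hb : ⟪f, psweep f⟫ *+ 4 <= ⟪f, f⟫ + ⟪psweep f, psweep f⟫ *+ 4.
  have := ip_ge0 w_gt0 (fun s => f s + (-2) * psweep f s).
  rewrite ipDl !ipDr !ipZl !ipZr [⟪psweep f, f⟫]ipC.
  by lra.
move: Hh; rewrite hE; lra.
Qed.

End Contraction.
End Sweeps.

(** * Blocks made of independent pieces *)

Section Decoupling.
Variables (R : realFieldType) (V : finType).
Implicit Types (a b : {set V}) (s t : {ffun V -> bool}) (w f g : {ffun V -> bool} -> R).

(** Conditional independence of the spins in [a] and in [b] given the others,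
    written as a product rule for weights so that no conditioning appears. *)
Definition decoupled w a b := forall s t, agree (a :|: b) s t ->
  w s * w t = w (mix a t s) * w (mix a s t).

Lemma mix_compl a b s t : [disjoint a & b] -> agree (a :|: b) s t ->
  mix b t s = mix a s t.
Proof.
move=> /pred0P dab /agreeP st; apply/ffunP => u; rewrite !ffunE.
have := dab u; have := st u; rewrite !inE /=.
by case: (u \in a); case: (u \in b) => //= H _; rewrite H.
Qed.

Lemma decoupledC w a b : [disjoint a & b] -> decoupled w a b -> decoupled w b a.
Proof.
move=> dab H s t; rewrite finset.setUC => st; rewrite (mix_compl dab st).
have ts : agree (a :|: b) t s by rewrite agree_sym.
by rewrite (mix_compl dab ts) (H _ _ st) mulrC.
Qed.

Section Weight.
Variable w : {ffun V -> bool} -> R.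
Hypothesis w_gt0 : forall s, 0 < w s.

(** Conditional independence for partition functions; both sides are double sums
    over the classes of [a] and [b], matched by exchanging the spins of [a]. *)
Lemma partf_decoupled a b s t : [disjoint a & b] -> decoupled w a b ->
  agree a s t -> partf w a s * partf w b t = w t * partf w (a :|: b) s.
Proof.
move=> dab dec st.
rewrite {3}/partf sum_agreeU // mulr_suml mulr_sumr; apply: eq_bigr => c sc.
rewrite [X in _ * X]/partf mulr_sumr [RHS]mulr_sumr.
have ct : agree a c t by apply: agree_trans st; rewrite agree_sym.
have bNa u : u \in b -> u \notin a.
  by move=> ub; apply: contraL dab => ua; apply/pred0Pn; exists u; apply/andP.
rewrite (reindex_onto (mix a t) (mix a c)) /= => [|e /agreeP te]; last first.
  apply/ffunP => u; rewrite !ffunE; case: (boolP (u \in a)) => // ua; apply: te.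
  by apply: contraL ua; exact: bNa.
apply: eq_big => [e|e /andP[te /eqP eE]].
  apply/andP/idP => [[/agreeP te /eqP eE]|/agreeP ce].
    rewrite -eE; apply/agreeP => u ub; rewrite !ffunE; case: (boolP (u \in a)) => // ua.
    by move/agreeP: ct => -> //; rewrite (te u ub) ffunE (negbTE ua).
  split; last first.
    apply/eqP/ffunP => u; rewrite !ffunE; case: (boolP (u \in a)) => // ua; apply: ce.
    by apply: contraL ua; exact: bNa.
  apply/agreeP => u ub; rewrite ffunE; case: (boolP (u \in a)) => // ua.
  by rewrite -ce //; move/agreeP: ct => ->.
rewrite dec; last first.
  apply/agreeP => u; rewrite !inE negb_or => /andP[ua ub].
  by rewrite ffunE (negbTE ua); move/agreeP: te => /(_ u ub); rewrite ffunE (negbTE ua);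
     move/agreeP: ct => ->.
congr (w _ * w _); apply/ffunP => u; rewrite !ffunE; case: (boolP (u \in a)) => // ua.
  by move/agreeP: ct => ->; rewrite ?ua.
by move/ffunP: eE => /(_ u); rewrite !ffunE ua.
Qed.

Lemma condE_decoupled a b f s : [disjoint a & b] -> decoupled w a b ->
  condE w a (condE w b f) s = condE w (a :|: b) f s.
Proof.
move=> dab dec.
apply: (mulfI (partf_neq0 w_gt0 (a :|: b) s)); rewrite -sum_condE //.
rewrite {1}/condE mulrA mulrC mulr_sumr mulr_sumr.
rewrite sum_agreeU //; apply: eq_bigr => t st.
rewrite mulrC {1}/condE.
have E := partf_decoupled dab dec st.
have Za := partf_neq0 w_gt0 a s; have Zb := partf_neq0 w_gt0 b t.
move: E; set A := partf w a s; set B := partf w b t => E.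
set X := \sum_(c | agree b t c) _; set P := partf _ _ _ in E *.
have -> : P * (w t * (X / B)) / A = (w t * P) * X / (A * B) by rewrite invfM; ring.
by rewrite -E mulrAC divff ?mul1r // mulf_neq0.
Qed.

(** The Efron-Stein inequality for two independent blocks: by Pythagoras the
    variance is that of [b] plus that of [a] for the [b]-average, and averaging
    over [b] contracts the latter. *)
Lemma condD_decoupled a b f : [disjoint a & b] -> decoupled w a b ->
  condD w (a :|: b) f <= condD w a f + condD w b f.
Proof.
move=> dab dec.
have -> : condD w (a :|: b) f = condD w b f + condD w a (condE w b f).
  rewrite !condDE // (eq_ipl _ _ (fun s => condE_decoupled f s dab dec)).
  by rewrite (eq_ipr _ _ (fun s => condE_decoupled f s dab dec)); ring.
rewrite addrC lerD2r.
pose k s := f s - condE w a f s.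
have -> : condD w a (condE w b f) = ip w (condE w b k) (condE w b k).
  apply: eq_bigr => s _; congr (_ * _).
  rewrite /k condEB condE_decoupled // [X in _ = (_ - X) * (_ - X)]condE_decoupled //.
  - by rewrite [b :|: a]finset.setUC expr2.
  - by rewrite disjoint_sym.
  - exact: decoupledC.
apply: le_trans (condE_contract w_gt0 _ _) _.
by rewrite le_eqVlt; apply/orP; left; apply/eqP; apply: eq_bigr => s _; rewrite expr2.
Qed.

Lemma condD_pieces (I : finType) (lab : V -> I) (B : {set V}) f :
  (forall (i : I) (J : {set I}), i \notin J ->
    decoupled w [set x in B | lab x == i] [set x in B | lab x \in J]) ->
  condD w B f <= \sum_i condD w [set x in B | lab x == i] f.
Proof.
move=> dec.
suff H (J : {set I}) : condD w [set x in B | lab x \in J] f <=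
    \sum_(i in J) condD w [set x in B | lab x == i] f.
  have := H [set: I]; rewrite (eq_bigl predT) => [|i]; last by rewrite inE.
  by congr (condD w _ f <= _); apply/finset.setP => x; rewrite !inE andbT.
elim/set_ind_U1: J => [|i J iJ IH].
  rewrite big_set0 (_ : [set x in B | _] = finset.set0); last first.
    by apply/finset.setP => x; rewrite !inE andbF.
  rewrite /condD big1 // => s _.
  by rewrite condE_set0 // subrr expr0n mulr0.
rewrite big_setU1 //= .
have -> : [set x in B | lab x \in i |: J] =
    [set x in B | lab x == i] :|: [set x in B | lab x \in J].
  by apply/finset.setP => x; rewrite !inE -andb_orr.
apply: le_trans (condD_decoupled _ _ _) _; last by rewrite lerD2l.
  apply/pred0P => x /=; rewrite !inE.
  by case: eqP => [->|]; rewrite ?andbF //= (negbTE iJ) !andbF.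
exact: dec.
Qed.

End Weight.

Lemma condD_compare (w w0 : {ffun V -> bool} -> R) k b f :
  (forall s, 0 < w s) -> (forall s, w s <= k * w0 s) ->
  condD w b f <= k * condD w0 b f.
Proof.
move=> wp wk.
apply: le_trans (condD_min wp _ (g := condE w0 b f) _) _.
  by move=> s t; exact: condE_agree.
rewrite /condD mulr_sumr; apply: ler_sum => s _.
by rewrite mulrA ler_wpM2r // sqr_ge0.
Qed.

End Decoupling.

(** * Ising weights *)

Section Ising.
Variables (R : realType) (V : finType).
Implicit Types (s t : {ffun V -> bool}) (J : V -> V -> R) (h : V -> R) (a b : {set V}).

Definition energy J h s : R :=
  2^-1 * \sum_u \sum_v J u v * (spin R (s u) * spin R (s v)) + \sum_u h u * spin R (s u).

Definition isingW J h s : R := expR (energy J h s).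

Lemma isingW_gt0 J h s : 0 < isingW J h s. Proof. exact: expR_gt0. Qed.

Lemma energy_pair_le J h s t s' t' :
  (forall u v, J u v * (spin R (s u) * spin R (s v)) + J u v * (spin R (t u) * spin R (t v)) <=
     J u v * (spin R (s' u) * spin R (s' v)) + J u v * (spin R (t' u) * spin R (t' v))) ->
  (forall u, spin R (s u) + spin R (t u) = spin R (s' u) + spin R (t' u)) ->
  energy J h s + energy J h t <= energy J h s' + energy J h t'.
Proof.
move=> HJ Hh; rewrite /energy addrACA [leRHS]addrACA.
rewrite -!mulrDr -!big_split /= lerD //.
  rewrite ler_pM2l ?invr_gt0 //; apply: ler_sum => u _.
  by rewrite -!big_split; apply: ler_sum => v _; exact: HJ.
rewrite le_eqVlt; apply/orP; left; apply/eqP; apply: eq_bigr => u _.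
by rewrite -!mulrDr Hh.
Qed.

Lemma isingW_supermod J h s t : (forall u v, 0 <= J u v) ->
  isingW J h s * isingW J h t <= isingW J h (joinc s t) * isingW J h (meetc s t).
Proof.
move=> J0; rewrite /isingW -!expRD ler_expR; apply: energy_pair_le => [u v|u].
  rewrite -!mulrDr ler_wpM2l // !ffunE /spin.
  by case: (s u); case: (s v); case: (t u); case: (t v) => //=; lra.
by rewrite !ffunE /spin; case: (s u); case: (t u) => //=; lra.
Qed.

(** Exchanging the spins of [a] between two configurations only rearranges the
    energy terms, provided that the outside spins coupled to [a] coincide. *)
Lemma isingW_swap J h a s t : (forall u v, J u v = J v u) ->
  (forall u v, u \in a -> v \notin a -> J u v != 0 -> s v = t v) ->
  isingW J h s * isingW J h t = isingW J h (mix a t s) * isingW J h (mix a s t).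
Proof.
move=> Jsym Hst; rewrite /isingW -!expRD.
have H u v : J u v * (spin R (s u) * spin R (s v)) + J u v * (spin R (t u) * spin R (t v)) =
    J u v * (spin R (mix a t s u) * spin R (mix a t s v)) +
    J u v * (spin R (mix a s t u) * spin R (mix a s t v)).
  have [->|J0] := eqVneq (J u v) 0; first by rewrite !mul0r.
  rewrite !ffunE; case: ifPn => ua; case: ifPn => va //; first exact: addrC.
    by rewrite (Hst _ _ ua va J0) addrC.
  by rewrite (Hst _ _ va ua) 1?Jsym // addrC.
have Hh u : spin R (s u) + spin R (t u) = spin R (mix a t s u) + spin R (mix a s t u).
  by rewrite !ffunE; case: ifP => //; rewrite addrC.
congr expR; apply/le_anti/andP; split; apply: energy_pair_le => // u *; by rewrite H.
Qed.

Lemma isingW_le J J0 h s :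
  isingW J h s <= expR (2^-1 * \sum_u \sum_v `|J u v - J0 u v|) * isingW J0 h s.
Proof.
rewrite /isingW -expRD ler_expR /energy addrA lerD2r -mulrDr ler_pM2l ?invr_gt0 //.
rewrite -big_split; apply: ler_sum => u _; rewrite -big_split; apply: ler_sum => v _ /=.
have : `|(J u v - J0 u v) * (spin R (s u) * spin R (s v))| <= `|J u v - J0 u v|.
  rewrite normrM ler_piMr // /spin.
  by case: (s u); case: (s v); rewrite ?(mulr1, mulrN1, normrN, opprK, normr1, mul1r).
by rewrite ler_norml => /andP[_]; rewrite mulrBl; lra.
Qed.

(** Deleting the couplings between the pieces of a block changes the weight by a
    bounded factor and makes the pieces conditionally independent. *)
Lemma condD_cut (I : finType) (lab : V -> I) J h (B : {set V}) f :
  (forall u v, J u v = J v u) ->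
  condD (isingW J h) B f <=
  expR (\sum_(u in B) \sum_(v in B | lab u != lab v) `|J u v|) *
  \sum_i condD (isingW J h) [set x in B | lab x == i] f.
Proof.
move=> Jsym.
pose J0 u v := if [&& u \in B, v \in B & lab u != lab v] then 0 else J u v.
have J0sym u v : J0 u v = J0 v u.
  rewrite /J0 [lab v == _]eq_sym Jsym andbCA.
  by case: (v \in B).
have DJ : \sum_u \sum_v `|J u v - J0 u v| =
    \sum_(u in B) \sum_(v in B | lab u != lab v) `|J u v|.
  rewrite [RHS]big_mkcond; apply: eq_bigr => u _.
  case: ifPn => uB; last first.
    by rewrite big1 // => v _; rewrite /J0 (negbTE uB) subrr normr0.
  rewrite [RHS]big_mkcond; apply: eq_bigr => v _.
  by rewrite /J0 uB /=; case: ifP => _; rewrite ?subr0 // subrr normr0.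
set M := \sum_(u in B) _ in DJ *.
have le1 s : isingW J h s <= expR (2^-1 * M) * isingW J0 h s.
  by rewrite -DJ; exact: isingW_le.
have le2 s : isingW J0 h s <= expR (2^-1 * M) * isingW J h s.
  rewrite -DJ (eq_bigr (fun u => \sum_v `|J0 u v - J u v|)); first exact: isingW_le.
  by move=> u _; apply: eq_bigr => v _; rewrite distrC.
have -> : M = 2^-1 * M + 2^-1 * M by lra.
rewrite expRD.
apply: le_trans (condD_compare B f (isingW_gt0 J h) le1) _.
rewrite -mulrA ler_pM2l ?expR_gt0 //.
apply: le_trans (@condD_pieces _ _ _ (isingW_gt0 J0 h) _ lab _ _ _) _.
  move=> i K iK s t /agreeP st; apply: isingW_swap => // u v.
  rewrite !inE => /andP[uB /eqP ui]; rewrite negb_and => /orP[vB|vi] J0v.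
    by apply: st; rewrite !inE (negbTE vB).
  apply: st; rewrite !inE negb_or !negb_and vi orbT /=.
  apply/orP; have [vB|] := boolP (v \in B); [right|by left].
  apply: contra J0v => vK; rewrite /J0 uB vB /=.
  by case: (lab u =P lab v) => [uv|_]; rewrite ?eqxx //; move: iK; rewrite -ui uv vK.
rewrite mulr_sumr; apply: ler_sum => i _.
exact: condD_compare (isingW_gt0 J0 h) le2.
Qed.

End Ising.

(** * Counting in the lattice, and cutting along grids *)

Lemma card_bigcup_le (I T : finType) (P : pred I) (F : I -> {set T}) :
  (#|\bigcup_(i | P i) F i| <= \sum_(i | P i) #|F i|)%N.
Proof.
elim/big_rec2: _ => [|i n A _ IH]; first by rewrite cards0.
by rewrite (leq_trans (leq_card_setU _ _)) // leq_add2l.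
Qed.

Section Geometry.
Variables (d : nat) (L : {fset 'rV[int]_d}).
Implicit Types (A V : {set L}) (u v x y : L).

Definition near1 u v : bool := [forall i : 'I_d, `|(val u) 0 i - (val v) 0 i| <= 1 :> int].

Lemma lattice_adjC (u v : 'rV[int]_d) : lattice_adj u v = lattice_adj v u.
Proof. by rewrite /lattice_adj; congr (_ == _); apply: eq_bigr => i _; rewrite distrC. Qed.

Lemma lattice_adj_near1 u v : lattice_adj (val u) (val v) -> near1 u v.
Proof.
move=> /eqP uv; apply/forallP => i; rewrite -uv (bigD1 i) //= lerDl.
exact: sumr_ge0.
Qed.

Lemma card_box_le A (lo : 'I_d -> int) (m : nat) : (0 < m)%N ->
  (forall x, x \in A -> forall i, lo i <= (val x) 0 i < lo i + m%:Z) ->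
  (#|A| <= m ^ d)%N.
Proof.
case: m => // m _ HA.
pose F x : {ffun 'I_d -> 'I_m.+1} := [ffun i => inord (absz ((val x) ord0 i - lo i))].
have Fi : {in A &, injective F}.
  move=> x y xA yA Fxy; apply/val_inj/rowP => i.
  have := HA _ xA i; have := HA _ yA i.
  move/ffunP: Fxy => /(_ i); rewrite !ffunE => /(congr1 val).
  move: ((val x) 0 i) ((val y) 0 i) (lo i) => a b l H Hb Ha; move: H.
  rewrite /= !inordK; try lia.
rewrite -(card_in_imset Fi) (leq_trans (max_card _)) //.
by rewrite card_ffun !card_ord.
Qed.

Lemma card_near1 u A : (forall v, v \in A -> near1 u v) -> (#|A| <= 3 ^ d)%N.
Proof.
move=> H; apply: (@card_box_le _ (fun i => (val u) 0 i - 1)) => // v vA i.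
have /forallP/(_ i) := H _ vA; lia.
Qed.

Lemma card_box_center u r : (#|box u r| <= (r.*2.+1) ^ d)%N.
Proof.
apply: (@card_box_le _ (fun i => (val u) 0 i - r%:Z)) => // v.
by rewrite inE => /forallP H i; have := H i; lia.
Qed.

Lemma card_ext_boundary A : (#|ext_boundary A| <= 3 ^ d * #|A|)%N.
Proof.
have sub : ext_boundary A \subset \bigcup_(u in A) [set v | near1 u v].
  apply/fintype.subsetP => v; rewrite inE => /andP[_ /existsP[u /andP[uA uv]]].
  by apply/bigcupP; exists u => //; rewrite inE lattice_adj_near1.
apply: leq_trans (subset_leq_card sub) _.
rewrite mulnC -sum_nat_const; apply: leq_trans (card_bigcup_le _ _) _.
by apply: leq_sum => u _; apply: (@card_near1 u) => v; rewrite inE.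
Qed.

(** The index of the cell of the cubic grid of mesh [g], translated by [-a] along
    the diagonal, that contains [x]. *)
Definition shifted_cell (g a : nat) (x : 'rV[int]_d) : 'rV[int]_d :=
  \row_i ((x ord0 i + a%:Z) %/ g%:Z)%Z.

(** The wall between [x] and [x + 1] belongs to the translate by [a] exactly when
    [g] divides [x + 1 + a], which determines [a] below [g]. *)
Lemma shift_uniq (g a a' : nat) (x y : int) : (0 < g)%N -> (a < g)%N -> (a' < g)%N ->
  `|x - y| <= 1 ->
  ((x + a%:Z) %/ g%:Z)%Z != ((y + a%:Z) %/ g%:Z)%Z ->
  ((x + a'%:Z) %/ g%:Z)%Z != ((y + a'%:Z) %/ g%:Z)%Z -> a = a'.
Proof.
move=> g0 ag a'g.
wlog: x y / x < y => [H xy qa qa'|xy xy1].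
  have [xly|yx|xeq] := ltgtP x y; first exact: (H x y).
    by apply: (H y x) => //; rewrite 1?distrC // eq_sym.
  by move: qa; rewrite xeq eqxx.
have -> : y = x + 1 by lia.
have key b : (b < g)%N -> ((x + b%:Z) %/ g%:Z)%Z != ((x + 1 + b%:Z) %/ g%:Z)%Z ->
    exists q : int, x + 1 + b%:Z = q * g%:Z.
  move=> bg qq; exists ((x + 1 + b%:Z) %/ g%:Z)%Z.
  have gz : g%:Z != 0 by lia.
  have := divz_eq (x + b%:Z) g%:Z; have := divz_eq (x + 1 + b%:Z) g%:Z.
  have := modz_ge0 (x + b%:Z) gz; have := modz_ge0 (x + 1 + b%:Z) gz.
  have := @ltz_pmod (x + b%:Z) g%:Z; have := @ltz_pmod (x + 1 + b%:Z) g%:Z.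
  move: qq; move: (_ %/ _)%Z (_ %/ _)%Z (_ %% _)%Z (_ %% _)%Z.
  move=> q q' r r'; nia.
move=> /(key _ ag)[q Hq] /(key _ a'g)[q' Hq'].
have : (q - q') * g%:Z = a%:Z - a'%:Z by lia.
have [-> |] := eqVneq q q'; first by lia.
nia.
Qed.

(** Averaging over the [g] translates of a grid of mesh [g], each edge is cut by
    at most [d] of them; hence some translate cuts few edges of [V]. *)
Lemma exists_good_grid (g : nat) V : (0 < g)%N ->
  exists lab : L -> {set L},
    (forall i, (#|[set x in V | lab x == i]| <= g ^ d)%N) /\
    (g * \sum_(u in V) \sum_(v in V | lab u != lab v) lattice_adj (val u) (val v)
       <= d * 3 ^ d * #|V|)%N.
Proof.
move=> g0.
pose lab (a : nat) x := [set y : L | shifted_cell g a (val y) == shifted_cell g a (val x)].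
have labE a x y : (lab a x == lab a y) = (shifted_cell g a (val x) == shifted_cell g a (val y)).
  apply/eqP/eqP => [E|E]; last by apply/finset.setP => z; rewrite !inE E.
  by have : x \in lab a y; [rewrite -E inE | rewrite inE => /eqP].
pose cut a := (\sum_(u in V) \sum_(v in V | lab a u != lab a v) lattice_adj (val u) (val v))%N.
have total : (\sum_(a < g) cut a <= d * 3 ^ d * #|V|)%N.
  rewrite exchange_big /= [leqRHS]mulnC -sum_nat_const; apply: leq_sum => u uV.
  under eq_bigr do rewrite big_mkcondr /=.
  rewrite exchange_big /=.
  apply: (@leq_trans (\sum_(v in V) d * lattice_adj (val u) (val v))).
    apply: leq_sum => v vV.
    case uv: (lattice_adj _ _); last by rewrite muln0 big1 // => a _; rewrite if_same.
    rewrite muln1 -big_mkcond sum1_card.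
    have /forallP nuv := lattice_adj_near1 uv.
    pose dif (i : 'I_d) := [set a : 'I_g | shifted_cell g a (val u) 0 i != shifted_cell g a (val v) 0 i].
    have sub : [pred a : 'I_g | lab a u != lab a v] \subset \bigcup_i dif i.
      apply/fintype.subsetP => a; rewrite inE labE => /eqP H.
      have [i Hi] : exists i, shifted_cell g a (val u) 0 i != shifted_cell g a (val v) 0 i.
        apply/existsP; rewrite -negb_forall; apply/negP => /forallP H'.
        by apply: H; apply/rowP => i; apply/eqP/H'.
      by apply/bigcupP; exists i => //; rewrite inE.
    apply: leq_trans (subset_leq_card sub) _.
    apply: leq_trans (card_bigcup_le _ _) _.
    rewrite -[leqRHS]mul1n -[X in (_ <= _ * X)%N]card_ord mulnC -sum_nat_const.
    apply: leq_sum => i _; apply/card_le1_eqP => a a'.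
    rewrite !inE !mxE => H H'; apply/val_inj.
    have E := shift_uniq g0 (ltn_ord a) (ltn_ord a') (nuv i) H H'.
    exact: esym.
  rewrite -big_distrr /= leq_mul2l; apply/orP; right.
  rewrite (eq_bigr (fun v => if lattice_adj (val u) (val v) then 1 else 0)%N); last first.
    by move=> v _; case: (lattice_adj _ _).
  rewrite -big_mkcondr sum1_card -cardsE.
  by apply: (@card_near1 u) => v; rewrite !inE => /andP[_ /lattice_adj_near1].
have [a ag Ha] : exists2 a, (a < g)%N & (g * cut a <= d * 3 ^ d * #|V|)%N.
  apply: contrapT => H; move: total; apply/negP; rewrite -ltnNge.
  have : (\sum_(a < g) (d * 3 ^ d * #|V|).+1 <= \sum_(a < g) g * cut a)%N.
    apply: leq_sum => a _; rewrite ltnNge; apply/negP => Ha; apply: H.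
    by exists a.
  rewrite sum_nat_const card_ord -big_distrr /= leq_pmul2l //.
exists (lab a); split => // i.
have [->|/set0Pn[x]] := eqVneq [set x in V | lab a x == i] finset.set0.
  by rewrite cards0.
rewrite inE => /andP[xV /eqP <-].
apply: (@card_box_le _ (fun j => shifted_cell g a (val x) 0 j * g%:Z - a%:Z)) => // y.
rewrite inE labE => /andP[_ /eqP yx] j; rewrite -yx !mxE.
have gz : g%:Z != 0 by lia.
have := divz_eq ((val y) 0 j + a%:Z) g%:Z; have := modz_ge0 ((val y) 0 j + a%:Z) gz.
have := @ltz_pmod ((val y) 0 j + a%:Z) g%:Z.
by move: (_ %/ _)%Z (_ %% _)%Z => q r; lia.
Qed.

Section BlockBound.
Variables (R : realType) (beta : R) (h : L -> R).
Hypothesis beta0 : 0 <= beta.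

Definition Jadj (u v : L) : R := beta * (lattice_adj (val u) (val v))%:R.

Local Notation W := (isingW Jadj h).

Lemma JadjC u v : Jadj u v = Jadj v u.
Proof. by rewrite /Jadj lattice_adjC. Qed.

Lemma sum_Jadj (B : {set L}) (P : rel L) (n : nat) :
  (\sum_(u in B) \sum_(v in B | P u v) lattice_adj (val u) (val v) <= n)%N ->
  \sum_(u in B) \sum_(v in B | P u v) `|Jadj u v| <= beta * n%:R.
Proof.
move=> Hn; apply: le_trans (ler_wpM2l beta0 (_ : _ <= n%:R)); last first.
  by rewrite -(ler_nat R) in Hn; exact: Hn.
rewrite natr_sum mulr_sumr; apply: ler_sum => u _.
rewrite natr_sum mulr_sumr; apply: ler_sum => v _.
by rewrite ger0_norm // mulr_ge0.
Qed.

(** Cutting a block into its sites: the bound is exponential in the volume. *)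
Lemma condD_single (B : {set L}) f :
  condD W B f <= expR (beta * (3 ^ d * #|B|)%:R) * \sum_(x in B) condD W [set x] f.
Proof.
apply: le_trans (condD_cut id h B f JadjC) _; apply: ler_pM.
- exact: expR_ge0.
- by apply: sumr_ge0 => x _; apply: condD_ge0 => s; exact: isingW_gt0.
- rewrite ler_expR; apply: sum_Jadj.
  rewrite mulnC -sum_nat_const; apply: leq_sum => u uB.
  rewrite (eq_bigr (fun v => if lattice_adj (val u) (val v) then 1 else 0)%N); last first.
    by move=> v _; case: (lattice_adj _ _).
  rewrite -big_mkcondr sum1_card -cardsE.
  by apply: (@card_near1 u) => v; rewrite !inE => /andP[_ /lattice_adj_near1].
- rewrite [leRHS]big_mkcond; apply: ler_sum => x _.
  case: ifPn => xB.
    rewrite (_ : [set y in B | id y == x] = [set x]) //.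
    by apply/finset.setP => y; rewrite !inE; case: eqP => [->|]; rewrite ?andbF ?andbT.
  rewrite (_ : [set y in B | id y == x] = finset.set0); last first.
    by apply/finset.setP => y; rewrite !inE; case: eqP => [->|]; rewrite ?andbF ?andbT // (negbTE xB).
  by rewrite /condD big1 // => s _; rewrite condE_set0 ?subrr ?expr0n ?mulr0 // => t; exact: isingW_gt0.
Qed.

(** Cutting along a good grid first replaces the volume in the exponent by about
    [#|V| / g + g ^ d]: surface terms for the grid, volume terms for its cells only.
    This gain is what makes clusters of [s ^ (d * d)] cells of side [s] affordable:
    with [g = s ^ d] both terms are of order [s ^ (d * d)]. *)
Lemma condD_block (n g : nat) (V : {set L}) f : (0 < g)%N -> (#|V| <= n * g)%N ->
  condD W V f <= expR (beta * (d * 3 ^ d * n + 3 ^ d * g ^ d)%:R) *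
    \sum_(x in V) condD W [set x] f.
Proof.
move=> g0 Vn; have [lab [lab_card lab_cut]] := exists_good_grid V g0.
rewrite natrD mulrDr expRD -mulrA.
apply: le_trans (condD_cut lab h V f JadjC) _; apply: ler_pM.
- exact: expR_ge0.
- by apply: sumr_ge0 => x _; apply: condD_ge0 => s; exact: isingW_gt0.
- rewrite ler_expR; apply: sum_Jadj.
  rewrite -(leq_pmul2l g0) (leq_trans lab_cut) // mulnC [leqRHS]mulnCA [(g * n)%N]mulnC.
  by rewrite mulnC leq_mul2l Vn orbT.
- rewrite [X in _ <= _ * X](partition_big lab predT) //= mulr_sumr; apply: ler_sum => i _.
  apply: le_trans (condD_single _ _) _.
  have -> : \sum_(x in [set x in V | lab x == i]) condD W [set x] f =
      \sum_(x in V | lab x == i) condD W [set x] f.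
    by apply: eq_bigl => x; rewrite inE.
  rewrite ler_wpM2r //; first by apply: sumr_ge0 => x _; apply: condD_ge0 => s; exact: isingW_gt0.
  by rewrite ler_expR ler_wpM2l // ler_nat leq_mul2l lab_card orbT.
Qed.

End BlockBound.
End Geometry.

(** * Locality of conditional expectations *)

Section Locality.
Variables (R : realType) (V : finType).
Implicit Types (s t : {ffun V -> bool}) (J : V -> V -> R) (h : V -> R) (a b : {set V})
  (f : {ffun V -> bool} -> R).

(** By the exchange identity, passing from the class of [t] to that of [s]
    multiplies all weights by one and the same factor. *)
Lemma condE_boundary J h a f s t : (forall u v, J u v = J v u) ->
  (forall u v, u \in a -> v \notin a -> J u v != 0 -> s v = t v) ->
  (forall s t, (forall u, u \in a -> s u = t u) -> f s = f t) ->
  condE (isingW J h) a f s = condE (isingW J h) a f t.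
Proof.
move=> Jsym st fa; pose k := isingW J h (mix a t s) / isingW J h t.
have wE e : agree a t e -> isingW J h (mix a e s) = k * isingW J h e.
  move=> /agreeP te; rewrite /k mulrAC; apply: (canRL (mulfK _)).
    by rewrite gt_eqF // isingW_gt0.
  rewrite (@isingW_swap _ _ _ _ a) // => [|u v ua va Juv]; last first.
    by rewrite ffunE (negbTE va); exact: st Juv.
  congr (isingW J h _ * isingW J h _); apply/ffunP => u; rewrite !ffunE; case: (boolP (u \in a)) => // ua.
  exact: te.
have k0 : k != 0 by rewrite gt_eqF // divr_gt0 // isingW_gt0.
have sumE (F : {ffun V -> bool} -> R) :
    \sum_(c | agree a s c) F c = \sum_(e | agree a t e) F (mix a e s).
  rewrite (reindex_onto (fun e => mix a e s) (fun c => mix a c t)) /= => [|c /agreeP sc].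
    apply: eq_bigl => e; apply/andP/idP => [[_ /eqP <-]|/agreeP te].
      by rewrite agree_sym agree_mix.
    split; first by rewrite agree_sym agree_mix.
    apply/eqP/ffunP => u; rewrite !ffunE; case: (boolP (u \in a)) => // ua.
    exact: te.
  apply/ffunP => u; rewrite !ffunE; case: (boolP (u \in a)) => // ua; exact: sc.
rewrite /condE /partf !sumE.
have fE e : f (mix a e s) = f e by apply: fa => u ua; rewrite ffunE ua.
rewrite (eq_bigr (fun e => k * (isingW J h e * f e))) => [|e te]; last first.
  by rewrite wE // fE mulrA.
rewrite -mulr_sumr [X in _ / X](eq_bigr (fun e => k * isingW J h e)) //.
by rewrite -mulr_sumr invfM mulrACA divff // mul1r.
Qed.

(** The fields outside [a] contribute a factor that is constant on each class. *)
Lemma condE_field J h h' a f s : (forall u, u \in a -> h u = h' u) ->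
  condE (isingW J h) a f s = condE (isingW J h') a f s.
Proof.
move=> hh; pose k := expR (\sum_(u | u \notin a) (h u - h' u) * spin R (s u)).
have wE t : agree a s t -> isingW J h t = k * isingW J h' t.
  move=> /agreeP st; rewrite /isingW /k -expRD /energy; congr expR.
  rewrite addrCA; congr (_ + _).
  rewrite [LHS](bigID (mem a)) [X in _ = _ + X](bigID (mem a)) /= [RHS]addrCA; congr (_ + _).
    by apply: eq_bigr => u ua; rewrite hh.
  by rewrite -big_split; apply: eq_bigr => u ua /=; rewrite st //; ring.
have k0 : k != 0 by rewrite gt_eqF // expR_gt0.
rewrite /condE /partf.
rewrite (eq_bigr (fun e => k * (isingW J h' e * f e))) => [|e te]; last first.
  by rewrite wE // mulrA.
rewrite -mulr_sumr [X in _ / X](eq_bigr (fun e => k * isingW J h' e)) //.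
by rewrite -mulr_sumr invfM mulrACA divff // mul1r.
Qed.

End Locality.

(** * The random field Ising model as an Ising weight *)

Section Link.
Variables (R : realType) (d : nat) (L : {fset 'rV[int]_d}) (beta : R) (h : L -> R).
Implicit Types (s t : config L) (A : {set L}) (phi : config L -> R).

Local Notation W := (isingW (@Jadj d L R beta) h).

Lemma rfim_weightE s : rfim_weight beta h s = W s.
Proof.
rewrite /rfim_weight /isingW /energy; congr expR; congr (_ + _).
rewrite mulrCA; congr (_ * _).
rewrite mulr_sumr; apply: eq_bigr => u _.
rewrite mulr_sumr [LHS]big_mkcond /=; apply: eq_bigr => v _; rewrite /Jadj.
by case: ifP => _; rewrite ?mulr1 // mulr0 mul0r.
Qed.

Definition Ztot := \sum_(s : config L) W s.

Lemma Ztot_gt0 : 0 < Ztot.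
Proof.
rewrite /Ztot (bigD1 (all_spins L true)) //= ltr_pwDl ?isingW_gt0 //.
by apply: sumr_ge0 => s _; rewrite ltW // isingW_gt0.
Qed.

Lemma rfimE s : rfim beta h s = W s / Ztot.
Proof.
rewrite /rfim rfim_weightE; congr (_ / _); apply: eq_bigr => t _.
exact: rfim_weightE.
Qed.

Lemma condE_plus_boundary A (o : L) s t : o \in A ->
  (forall u, u \in ext_boundary A -> s u = t u) ->
  condE W A (@plus_at R L o) s = condE W A (@plus_at R L o) t.
Proof.
move=> oA st; apply: condE_boundary.
- exact: JadjC.
- move=> u v uA vA; rewrite /Jadj => J0; apply: st; rewrite inE vA /=.
  apply/existsP; exists u; rewrite uA /=.
  by move: J0; case: (lattice_adj _ _) => //; rewrite mulr0 eqxx.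
- by move=> s' t' st'; rewrite /plus_at st'.
Qed.

(** Conditioning on the boundary spins averages the conditional expectation given
    all outside spins, and the latter depends on the boundary spins alone. *)
Lemma rfim_bc_spinE A (tau : config L) (o : L) (b : bool) : o \in A ->
  rfim_bc_spin beta h A tau o b =
  if b then condE W A (@plus_at R L o) tau else 1 - condE W A (@plus_at R L o) tau.
Proof.
move=> oA; rewrite /rfim_bc_spin /pmf_cond /pmf_prob.
set F := [set s : config L | [forall v in ext_boundary A, s v == tau v]].
pose IF s : R := (s \in F)%:R.
set p := condE W A (@plus_at R L o) tau.
have Wp := @isingW_gt0 R L (@Jadj d L R beta) h.
have Zn : Ztot != 0 by rewrite gt_eqF // Ztot_gt0.
have den : \sum_(x in F) rfim beta h x = ip W IF (fun=> 1) / Ztot.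
  rewrite /ip mulr_suml big_mkcond; apply: eq_bigr => s _; rewrite rfimE /IF mulr1.
  by case: (s \in F); rewrite ?mulr1 // mulr0 mul0r.
have FA s t : agree A s t -> (s \in F) = (t \in F).
  wlog suff H : s t / agree A s t -> s \in F -> t \in F.
    by move=> st; apply/idP/idP; apply: H => //; rewrite agree_sym.
  move=> /agreeP st; rewrite !inE => /forallP sF; apply/forallP => v; apply/implyP => vb.
  rewrite -st; first by have := sF v; rewrite vb.
  by move: vb; rewrite inE => /andP[].
have IFE : IF =1 condE W A IF.
  by move=> s; rewrite condE_const // => t st; rewrite /IF (FA _ _ st).
have num : ip W IF (@plus_at R L o) = ip W IF (fun=> 1) * p.
  rewrite (eq_ipl _ _ IFE) condE_sa // /ip mulr_suml; apply: eq_bigr => s _.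
  rewrite /IF; case sF: (s \in F); last by rewrite !mul0r mulr0 mul0r.
  rewrite mulr1 !mul1r mulr1; congr (_ * _); apply: condE_plus_boundary => // u ub.
  by move: sF; rewrite inE => /forallP /(_ u); rewrite ub => /eqP.
have IF0 : 0 < ip W IF (fun=> 1).
  rewrite /ip (bigD1 tau) //= ltr_pwDl //.
    rewrite mulr_gt0 // mulr1 /IF; have -> : tau \in F; last exact: ltr01.
    by rewrite inE; apply/forallP => v; apply/implyP.
  by apply: sumr_ge0 => s _; rewrite mulr1 mulr_ge0 ?ler0n // ltW.
have plus : \sum_(x in [set s : config L | s o == true] :&: F) rfim beta h x =
    ip W IF (@plus_at R L o) / Ztot.
  rewrite /ip mulr_suml big_mkcond; apply: eq_bigr => s _; rewrite rfimE /IF /plus_at.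
  rewrite finset.in_setI andbC (_ : (s \in [set s0 : config L | s0 o == true]) = s o); last by rewrite inE eqb_id.
  by case: (s \in F); case: (s o) => /=; rewrite ?(mulr1, mulr0, mul0r).
have tot : \sum_(x in [set s : config L | s o == true] :&: F) rfim beta h x +
   \sum_(x in [set s : config L | s o == false] :&: F) rfim beta h x =
   \sum_(x in F) rfim beta h x.
  rewrite [RHS](bigID (fun s => s o)) /=.
  congr (_ + _); apply: eq_bigl => s; rewrite finset.in_setI andbC.
    by congr (_ && _); rewrite inE eqb_id.
  by congr (_ && _); rewrite inE eqbF_neg.
case: b.
  rewrite plus den num; field; by rewrite Zn gt_eqF.
have -> : \sum_(x in [set s : config L | s o == false] :&: F) rfim beta h x =
  \sum_(x in F) rfim beta h x - ip W IF (@plus_at R L o) / Ztot by rewrite -plus -tot; ring.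
rewrite den num; field; by rewrite Zn gt_eqF.
Qed.

(** The influence on the spin at [o] of the boundary of [A]: the quantity whose
    mean is controlled by weak spatial mixing. *)
Definition bcgap A (o : L) : R :=
  dTV (rfim_bc_spin beta h A (all_spins L true) o)
      (rfim_bc_spin beta h A (all_spins L false) o).

Lemma bcgapE A (o : L) : o \in A ->
  bcgap A o = `|condE W A (@plus_at R L o) (all_spins L true) -
                condE W A (@plus_at R L o) (all_spins L false)|.
Proof.
move=> oA; rewrite /bcgap /dTV big_bool !rfim_bc_spinE //.
set p := condE _ _ _ _; set q := condE _ _ _ _.
have -> : 1 - p - (1 - q) = - (p - q) by ring.
rewrite normrN /=; lra.
Qed.

Lemma bcgap_ge0 A o : 0 <= bcgap A o.
Proof. by rewrite mulr_ge0 ?invr_ge0 // sumr_ge0. Qed.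

(** By attractivity the two constant boundary conditions are extremal. *)
Lemma condE_plus_bcgap A (o : L) s t : 0 <= beta -> o \in A ->
  condE W A (@plus_at R L o) s - condE W A (@plus_at R L o) t <= bcgap A o.
Proof.
move=> b0 oA; rewrite bcgapE //; apply: le_trans (ler_norm _).
have Wp := @isingW_gt0 R L (@Jadj d L R beta) h.
have Ws s' t' : W s' * W t' <= W (joinc s' t') * W (meetc s' t').
  by apply: isingW_supermod => u v; rewrite mulr_ge0.
have inc := @condE_increasing _ _ _ Wp Ws A _ (@plus_at_increasing R L o).
apply: lerB; apply: inc; apply/lecP => u; rewrite ffunE //.
Qed.

End Link.

(** * Single-site variances and the Dirichlet form *)

Section SingleFlip.
Variables (R : realType) (V : finType) (w : {ffun V -> bool} -> R).
Hypothesis w_gt0 : forall s, 0 < w s.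
Implicit Types (s t : {ffun V -> bool}) (f : {ffun V -> bool} -> R).

Definition flip (x : V) s : {ffun V -> bool} := setsp x (~~ s x) s.

Lemma flipE x s u : flip x s u = if u == x then ~~ s x else s u.
Proof. by rewrite ffunE. Qed.

Lemma flip_inj s : injective (fun x => flip x s).
Proof.
move=> x y E; have := congr1 (fun g : {ffun V -> bool} => g x) E.
by rewrite !flipE eqxx; case: (x =P y) => [->//|_]; case: (s x).
Qed.

Lemma flipK x : involutive (flip x).
Proof.
move=> s; apply/ffunP => u; rewrite !ffunE eqxx.
by case: eqP => // ->; rewrite negbK.
Qed.

Lemma sum_agree_flip x s (F : {ffun V -> bool} -> R) :
  \sum_(t | agree [set x] s t) F t = F s + F (flip x s).
Proof.
have sE : setsp x (s x) s = s by apply/ffunP => u; rewrite ffunE; case: eqP => // ->.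
rewrite sum_agree1 /flip; case: (s x) sE => /= sE; rewrite sE // addrC //.
Qed.

Lemma condD_flip x f :
  condD w [set x] f =
  2^-1 * \sum_s w s * w (flip x s) / (w s + w (flip x s)) * (f s - f (flip x s)) ^+ 2.
Proof.
have E s : w s * (f s - condE w [set x] f s) ^+ 2 =
    w s * w (flip x s) ^+ 2 / (w s + w (flip x s)) ^+ 2 * (f s - f (flip x s)) ^+ 2.
  rewrite /condE /partf !sum_agree_flip; field.
  by rewrite gt_eqF // addr_gt0.
have D2 : condD w [set x] f = \sum_s w (flip x s) * w s ^+ 2 /
    (w s + w (flip x s)) ^+ 2 * (f s - f (flip x s)) ^+ 2.
  rewrite /condD (reindex_inj (inv_inj (flipK x))); apply: eq_bigr => s _.
  rewrite E flipK; field.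
  by rewrite !gt_eqF // addr_gt0.
have -> : condD w [set x] f = 2^-1 * (condD w [set x] f + condD w [set x] f) by lra.
congr (_ * _); rewrite {2}D2 {1}/condD -big_split; apply: eq_bigr => s _ /=.
rewrite E; field.
by rewrite gt_eqF // addr_gt0.
Qed.

End SingleFlip.

Section Poincare.
Variables (R : realType) (d : nat) (L : {fset 'rV[int]_d}) (beta : R) (h : L -> R).
Implicit Types (s t : config L) (A : {set L}) (phi : config L -> R).

Local Notation W := (isingW (@Jadj d L R beta) h).
Local Notation Z := (Ztot beta h).
Local Notation mu := (rfim beta h).

Let Wp := @isingW_gt0 R L (@Jadj d L R beta) h.

Lemma sum_differ s (F : config L -> R) :
  \sum_(t | differ_at_one s t) F t = \sum_x F (flip x s).
Proof.
have inj := in2W (@flip_inj L s) : {in [set: L] &, injective (fun x => flip x s)}.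
rewrite [RHS](eq_bigl (mem [set: L])) => [|x]; last by rewrite /= finset.in_setT.
rewrite -(big_imset F inj) /=; apply: eq_bigl => t.
apply/idP/imsetP => [/card1P[x Hx]|[x _ ->]].
  exists x; rewrite ?finset.in_setT //; apply/ffunP => u; rewrite flipE.
  have := Hx u; rewrite !inE; case: (u =P x) => [->|_]; first by case: (s x) (t x) => [] [].
  by move/negbFE/eqP.
apply/card1P; exists x => u; rewrite !inE flipE.
by case: (u =P x) => [->|]; [case: (s x)|rewrite eqxx].
Qed.

Lemma dirichletE phi :
  dirichlet mu phi = (\sum_x condD W [set x] phi) / Z.
Proof.
have Zn : Z != 0 by rewrite gt_eqF // Ztot_gt0.
rewrite /dirichlet; under [in RHS]eq_bigr => x _ do rewrite condD_flip //.
rewrite -mulr_sumr -mulrA; congr (_ * _).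
rewrite exchange_big mulr_suml; apply: eq_bigr => s _ /=.
rewrite sum_differ mulr_suml; apply: eq_bigr => x _.
rewrite !rfimE; field.
have P1 := Wp s; have P2 := Wp (flip x s).
by rewrite Zn gt_eqF ?addr_gt0 //= -mulrDl mulf_neq0 ?invr_neq0 // gt_eqF // addr_gt0.
Qed.

Lemma rfim_sum1 : \sum_s mu s = 1.
Proof.
under eq_bigr => s _ do rewrite rfimE.
by rewrite -mulr_suml mulfV // gt_eqF // Ztot_gt0.
Qed.

Lemma rfim_ge0 s : 0 <= mu s.
Proof. by rewrite rfimE divr_ge0 ?ltW // Ztot_gt0. Qed.

Lemma pmf_varE phi (m := pmf_mean mu phi) :
  pmf_var mu phi = \sum_s mu s * (phi s - m) ^+ 2.
Proof.
have -> : \sum_s mu s * (phi s - m) ^+ 2 =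
    \sum_s mu s * phi s ^+ 2 - (\sum_s mu s * phi s) * (m *+ 2) + (\sum_s mu s) * m ^+ 2.
  by rewrite !mulr_suml -sumrB -big_split; apply: eq_bigr => s _ /=; ring.
by rewrite rfim_sum1 /pmf_var -/m -/(pmf_mean mu phi) -/m /pmf_mean; ring.
Qed.

Lemma osc_ge phi s t : phi s - phi t <= osc phi.
Proof.
apply: lerB; first exact: (le_bigmax _ phi s).
exact: (bigmin_le _ t phi).
Qed.

Lemma pmf_var_osc phi : pmf_var mu phi <= osc phi ^+ 2.
Proof.
have o0 : 0 <= osc phi.
  by have := osc_ge phi (all_spins L true) (all_spins L true); rewrite subrr.
rewrite pmf_varE; set m := pmf_mean mu phi.
have H s : `|phi s - m| <= osc phi.
  have -> : phi s - m = \sum_t mu t * (phi s - phi t).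
    under eq_bigr => t _ do rewrite mulrBr.
    by rewrite sumrB -mulr_suml rfim_sum1 mul1r.
  apply: le_trans (ler_norm_sum _ _ _) _.
  rewrite -[leRHS]mul1r -rfim_sum1 mulr_suml; apply: ler_sum => t _.
  rewrite normrM ger0_norm ?rfim_ge0 // ler_wpM2l ?rfim_ge0 //.
  rewrite ler_norml osc_ge andbT lerNl opprB; exact: osc_ge.
rewrite -[leRHS]mul1r -rfim_sum1 mulr_suml; apply: ler_sum => s _.
by rewrite ler_wpM2l ?rfim_ge0 // -[leLHS]real_normK ?num_real // ler_sqr ?nnegrE.
Qed.

(** Only the comparison of the two constant boundary conditions enters: a box
    around a good site may meet bad clusters, and no mixing with part of the
    configuration frozen is required. *)
Theorem rfim_poincare (blk : L -> {set L}) (good : {set L}) (theta Gam : R) phi :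
  0 <= beta -> 0 <= theta -> theta <= 2^-1 ->
  (forall v, v \in blk v) ->
  (forall v, v \in good -> bcgap beta h (blk v) v * #|ext_boundary (blk v)|%:R <= theta) ->
  (forall v, v \notin good -> ext_boundary (blk v) \subset good) ->
  (forall v, v \notin good -> theta * #|ext_boundary (blk v)|%:R <= 2^-1) ->
  (forall v f, condD W (blk v) f <= Gam * \sum_x condD W [set x] f) ->
  pmf_var mu phi <= 8 * #|{: L}|%:R * Gam * dirichlet mu phi.
Proof.
move=> b0 t0 t2 vblk goodb badb badt GamP.
have Ws s' t' : W s' * W t' <= W (joinc s' t') * W (meetc s' t').
  by apply: isingW_supermod => u v; rewrite mulr_ge0.
set m := pmf_mean mu phi; pose f s := phi s - m.
have Zp : 0 < Z by exact: Ztot_gt0.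
have f0 : ip W f (fun=> 1) = 0.
  have : \sum_s mu s * f s = 0.
    rewrite /f; under eq_bigr => t _ do rewrite mulrBr.
    by rewrite sumrB -mulr_suml rfim_sum1 mul1r subrr.
  under eq_bigr => s _ do rewrite rfimE mulrAC.
  rewrite -mulr_suml => /eqP; rewrite mulf_eq0 invr_eq0 (gt_eqF Zp) orbF => /eqP E.
  by rewrite -[RHS]E; apply: eq_bigr => s _; rewrite mulr1.
have BP := @block_poincare _ _ W Wp Ws blk good
  (fun v => ext_boundary (blk v)) (fun v => bcgap beta h (blk v) v) theta t0 t2
  (fun v s t st => condE_plus_boundary _ _ (vblk v) st)
  (fun v _ => bcgap_ge0 _ _ _ _)
  (fun v s t _ => condE_plus_bcgap _ _ _ b0 (vblk v)) goodb badb badt f f0.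
have varE : pmf_var mu phi = ip W f f / Z.
  rewrite pmf_varE mulr_suml; apply: eq_bigr => s _.
  by rewrite rfimE mulrAC expr2.
have condDf B : condD W B f = condD W B phi.
  apply: eq_bigr => s _; congr (_ * _ ^+ 2).
  by rewrite condEB /f (@condE_const _ _ _ Wp _ (fun=> m)) //; ring.
rewrite varE dirichletE mulrA ler_pM2r ?invr_gt0 //.
apply: le_trans BP _; rewrite -!mulrA ler_pM2l //.
rewrite [leRHS]mulr_natl -sumr_const; apply: ler_sum => v _.
rewrite condDf; exact: GamP.
Qed.

End Poincare.

(** * Counting lattice animals *)

Section Clusters.
Variables (K : finType) (a : rel K).
Implicit Types (S A : {set K}) (j k : K).

Definition adj_in S : rel K := fun x y => [&& x \in S, y \in S & a x y].

(** The connected component of [k] in the subgraph induced by [S]. *)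
Definition clump S k : {set K} := [set j | connect (adj_in S) k j].

Definition outer A : {set K} := [set j | (j \notin A) && [exists i in A, a i j]].

Lemma clump_refl S k : k \in clump S k.
Proof. by rewrite inE connect0. Qed.

Lemma clump_sub S k : k \in S -> clump S k \subset S.
Proof.
move=> kS; apply/fintype.subsetP => j; rewrite inE => /connectP[p].
elim/last_ind: p j => [|p x _] j /=; first by move=> _ ->.
by rewrite rcons_path last_rcons => /andP[_ /and3P[_ xS _]] ->.
Qed.

Lemma clump_step S k i j : i \in clump S k -> i \in S -> j \in S -> a i j ->
  j \in clump S k.
Proof.
rewrite !inE => ki iS jS aij; apply: connect_trans ki (connect1 _).
exact/and3P.
Qed.

Lemma clump_ind S k (D : {set K}) : k \in D ->
  (forall i j, i \in D -> i \in S -> j \in S -> a i j -> j \in D) ->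
  clump S k \subset D.
Proof.
move=> kD HD; apply/fintype.subsetP => j; rewrite inE => /connectP[p].
elim/last_ind: p j => [|p x IH] j /=; first by move=> _ ->.
rewrite rcons_path last_rcons => /andP[pp /and3P[lS xS alx]] ->.
by apply: HD lS xS alx; exact: IH.
Qed.

Lemma clump_idem S k : k \in S -> clump (clump S k) k = clump S k.
Proof.
move=> kS; apply/eqP; rewrite finset.eqEsubset; apply/andP; split.
  by apply: clump_sub; exact: clump_refl.
apply: clump_ind; first exact: clump_refl.
move=> i j iC iS jS aij.
have iC' : i \in clump S k.
  by have /fintype.subsetP := @clump_sub (clump S k) k (clump_refl _ _); apply.
have jC' : j \in clump S k := clump_step iC' iS jS aij.
exact: (clump_step iC iC' jC' aij).
Qed.

Lemma clump_outer S k j : k \in S -> j \in outer (clump S k) -> j \notin S.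
Proof.
move=> kS; rewrite inE => /andP[jC /existsP[i /andP[iC aij]]].
apply: contra jC => jS; apply: (clump_step iC _ jS aij).
exact: (fintype.subsetP (clump_sub kS)).
Qed.

Lemma clump_eq A S k : clump A k = A -> A \subset S -> [disjoint S & outer A] ->
  clump S k = A.
Proof.
move=> AE /fintype.subsetP AS dS; have kA : k \in A by rewrite -AE clump_refl.
apply/eqP; rewrite finset.eqEsubset; apply/andP; split.
  apply: clump_ind => // i j iA _ jS aij; apply/negPn/negP => jA.
  move/pred0P: dS => /(_ j) /=; rewrite jS inE jA /=.
  by move/existsP; apply; exists i; rewrite iA.
rewrite -{1}AE; apply: clump_ind; first exact: clump_refl.
by move=> i j iC iA jA aij; apply: (clump_step iC _ _ aij); exact: AS.
Qed.

Variable Delta : nat.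
Hypothesis degree : forall k, (#|[set j | a k j]| <= Delta)%N.

Lemma card_outer A : (#|outer A| <= Delta * #|A|)%N.
Proof.
have sub : outer A \subset \bigcup_(i in A) [set j | a i j].
  apply/fintype.subsetP => j; rewrite inE => /andP[_ /existsP[i /andP[iA aij]]].
  by apply/bigcupP; exists i => //; rewrite inE.
apply: leq_trans (subset_leq_card sub) _.
rewrite mulnC -sum_nat_const.
by apply: leq_trans (card_bigcup_le _ _) _; apply: leq_sum => i _.
Qed.

(** Counting by a coin-tossing argument: a uniformly random set [S] has [A] as the
    clump of [k] as soon as it contains [A] and avoids the neighbours of [A],
    which has probability at least [2^-((Delta + 1) |A|)], and these events are
    disjoint for distinct [A]. *)
Lemma sum_animals (R : realFieldType) k :
  \sum_(A | clump A k == A) ((2^-1 : R) ^+ (Delta.+1 * #|A|)) <= 1.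
Proof.
pose cnt A := #|[set S : {set K} | clump S k == A]|.
have cnt_ge A : clump A k == A -> (2 ^ #|K| <= 2 ^ (Delta.+1 * #|A|) * cnt A)%N.
  move=> /eqP AE; pose B := ~: (A :|: outer A).
  have Bcard : (#|K| <= Delta.+1 * #|A| + #|B|)%N.
    rewrite -(cardsC (A :|: outer A)) leq_add2r (leq_trans (leq_card_setU _ _)) //.
    by rewrite mulSn leq_add2l card_outer.
  have Bcnt : (2 ^ #|B| <= cnt A)%N.
    rewrite -card_powerset.
    have inj : {in powerset B &, injective (fun U => A :|: U)}.
      have key U : U \in powerset B -> U = (A :|: U) :\: A.
        rewrite powersetE => /fintype.subsetP UB; apply/finset.setP => x; rewrite !inE.
        case xA: (x \in A) => //=; apply/negP => /UB.
        by rewrite !inE xA.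
      by move=> U U' UB U'B E; rewrite (key _ UB) (key _ U'B) E.
    rewrite -(card_in_imset inj); apply: subset_leq_card; apply/fintype.subsetP => S.
    move=> /imsetP[U]; rewrite powersetE => /fintype.subsetP UB ->; rewrite inE; apply/eqP.
    apply: clump_eq => //; first exact: finset.subsetUl.
    apply/pred0P => x /=; rewrite !inE; apply/negP => /andP[/orP[->//|xU]].
    have := UB _ xU; rewrite !inE negb_or => /andP[_].
    by move=> /negbTE ->.
  apply: leq_trans (_ : 2 ^ (Delta.+1 * #|A| + #|B|) <= _)%N; first by rewrite leq_exp2l.
  by rewrite expnD leq_mul2l Bcnt orbT.
have total : (\sum_(A : {set K}) cnt A = 2 ^ #|K|)%N.
  rewrite -cardsT -card_powerset -sum1_card.
  rewrite [RHS](partition_big (fun S => clump S k) predT) //=.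
  apply: eq_bigr => A _; rewrite /cnt -sum1_card; apply: eq_bigl => S.
  by rewrite !inE finset.subsetT.
apply: (@le_trans _ _ (\sum_(A : {set K}) (cnt A)%:R / 2 ^+ #|K|)); last first.
  by rewrite -mulr_suml -natr_sum total natrX divff // expf_neq0 // pnatr_eq0.
rewrite big_mkcond; apply: ler_sum => A _; case: ifPn => [AE|_]; last first.
  by rewrite divr_ge0 // exprn_ge0.
rewrite ler_pdivlMr ?exprn_gt0 // exprVn mulrC ler_pdivrMr ?exprn_gt0 //.
by rewrite -!natrX -natrM ler_nat mulnC cnt_ge.
Qed.

End Clusters.

Lemma pigeonhole_colour (K C : finType) (col : K -> C) (A : {set K}) :
  A != finset.set0 ->
  exists c, (#|A| <= #|C| * #|[set k in A | col k == c]|)%N.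
Proof.
move=> /set0Pn[k0 k0A]; apply: contrapT => H.
have : (\sum_(c : C) #|C| * #|[set k in A | col k == c]| < #|C| * #|A|)%N.
  rewrite -sum_nat_const (bigD1 (col k0)) //= [ltnRHS](bigD1 (col k0)) //=.
  rewrite -addSn leq_add //; last apply: leq_sum => c _.
    by rewrite ltnNge; apply/negP => Hc; apply: H; exists (col k0).
  by rewrite ltnW // ltnNge; apply/negP => Hc; apply: H; exists c.
rewrite -big_distrr /= (_ : \sum_c _ = #|A|)%N ?ltnn //.
rewrite -sum1_card (partition_big col predT) //=; apply: eq_bigr => c _.
by rewrite -sum1_card; apply: eq_bigl => k; rewrite inE.
Qed.

(** * Independence of events that depend on disjoint groups of variables *)

Section Independence.
Local Open Scope classical_set_scope.
Context (R : realType) (disp : measure_display) (T : measurableType disp)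
  (P : probability T R) (I : finType) (X : I -> {RV P >-> R}).
Hypothesis indepX : mutually_independent X.
Implicit Types (J M : {set I}) (B : I -> set R) (E F : set T).

(** Rectangles form a generating system, stable under intersection, of the events
    that depend on the variables indexed by [J]. *)
Definition rect J B : set T := [set w | forall i, i \in J -> B i (X i w)].

Definition rects J : set (set T) :=
  [set E | exists2 B, (forall i, measurable (B i)) & E = rect J B].

Lemma rects_setI J : setI_closed (rects J).
Proof.
move=> _ _ [B mB ->] [B' mB' ->]; exists (fun i => B i `&` B' i).
  by move=> i; exact: measurableI.
apply/seteqP; split => w /=.
  by move=> [H H'] i iJ; split; [exact: H|exact: H'].
by move=> H; split => i iJ; case: (H i iJ).
Qed.

Lemma measurable_rect J B : (forall i, measurable (B i)) -> measurable (rect J B).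
Proof.
move=> mB; have -> : rect J B = \bigcap_(i in [set i | i \in J]) (X i @^-1` B i).
  by apply/seteqP; split => w /= H i /H.
apply: fin_bigcap_measurable => // i _.
by rewrite -[X in measurable X]setTI; exact: measurable_funP.
Qed.

Lemma rects_measurable J E : <<s rects J >> E -> measurable E.
Proof.
apply: smallest_sub; first exact: sigma_algebra_measurable.
by move=> _ [B mB ->]; exact: measurable_rect.
Qed.

Lemma rects_setT J : rects J setT.
Proof. by exists (fun=> setT) => //; apply/seteqP; split. Qed.

(** Both sides are finite measures in [F] that agree on rectangles. *)
Lemma rects_extend J E : measurable E ->
  (forall F, rects J F -> P (F `&` E) = P F * P E)%E ->
  forall F, <<s rects J >> F -> (P (F `&` E) = P F * P E)%E.
Proof.
move=> mE H F sF.
have r0 : 0 <= fine (P E) by rewrite fine_ge0.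
(* Both sides as measures: the restriction of [P] to [E], and [P] scaled. *)
pose m1 : {measure set T -> \bar R} := mrestr P mE.
pose m2 : {measure set T -> \bar R} := mscale (NngNum r0) P.
have PE : (P E = (fine (P E))%:E)%E by rewrite fineK // fin_num_measure.
have m2E A : (m2 A = P A * P E)%E by rewrite PE muleC.
rewrite -m2E -[LHS]/(m1 F).
apply: (@g_sigma_algebra_measure_unique _ _ _ (rects J) _ (fun=> setT) _ _ m1 m2) => //.
- by move=> _ [B mB ->]; exact: measurable_rect.
- by move=> _; exact: rects_setT.
- by rewrite bigcup_const.
- exact: rects_setI.
- by move=> A rA; rewrite m2E; exact: H.
- move=> _; rewrite /m1 /= /mrestr.
  by apply: le_lt_trans (ltry 1); apply: probability_le1; exact: measurableI.
Qed.

Lemma rect_indep J M B : [disjoint J & M]%B -> (forall i, measurable (B i)) ->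
  (P (rect (J :|: M)%SET B) = P (rect J B) * P (rect M B))%E.
Proof.
move=> dJM mB; rewrite /rect !indepX //.
by rewrite -bigU //; apply: eq_bigl => i; rewrite !inE.
Qed.

(** Events that depend on disjoint groups of the variables are independent: the
    product rule is extended from rectangles one group at a time. *)
Lemma indep_groups (K : finType) (J : K -> {set I}) (F : K -> set T) (A : {set K}) :
  (forall k k', k \in A -> k' \in A -> k != k' -> [disjoint J k & J k']%B) ->
  (forall k, k \in A -> <<s rects (J k) >> (F k)) ->
  P [set w | forall k, k \in A -> F k w] = (\prod_(k in A) P (F k))%E.
Proof.
pose ev (A : {set K}) := [set w | forall k, k \in A -> F k w].
suff gen M B : (forall i, measurable (B i)) ->
    (forall k k', k \in A -> k' \in A -> k != k' -> [disjoint J k & J k']%B) ->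
    (forall k, k \in A -> [disjoint J k & M]%B) ->
    (forall k, k \in A -> <<s rects (J k) >> (F k)) ->
    P (ev A `&` rect M B) = ((\prod_(k in A) P (F k)) * P (rect M B))%E.
  move=> dis sF; have := gen finset.set0 (fun=> setT) (fun=> measurableT) dis _ sF.
  have -> : rect finset.set0 (fun=> setT) = setT by apply/seteqP; split.
  by rewrite setIT probability_setT mule1; apply => k _; apply/pred0P => i /=; rewrite finset.in_set0 andbF.
have mev (A' : {set K}) : (forall k, k \in A' -> <<s rects (J k) >> (F k)) -> measurable (ev A').
  move=> sF; have -> : ev A' = \bigcap_(k in [set k | k \in A']) F k.
    by apply/seteqP; split => w /= H k /H.
  by apply: fin_bigcap_measurable => // k kA; apply: rects_measurable; exact: sF.
elim/set_ind_U1: A M B => [|k A kA IH] M B mB dis disM sF.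
  rewrite big_set0 mul1e (_ : ev finset.set0 = setT) ?setTI //.
  by apply/seteqP; split => // w _ k; rewrite inE.
have kU : k \in k |: A by rewrite !inE eqxx.
have AU j : j \in A -> j \in k |: A by rewrite !inE orbC => ->.
have {}IH M' B' : (forall i, measurable (B' i)) ->
    (forall j, j \in A -> [disjoint J j & M']%B) ->
    P (ev A `&` rect M' B') = ((\prod_(j in A) P (F j)) * P (rect M' B'))%E.
  move=> mB' dM'; apply: IH => // [j j' jA j'A|j jA]; last by apply: sF; exact: AU.
  by apply: dis; exact: AU.
have evU : ev (k |: A) = F k `&` ev A.
  apply/seteqP; split => w /=.
    by move=> H; split => [|j jA]; apply: H => //; exact: AU.
  by move=> [Hk HA] j; rewrite !inE => /orP[/eqP->//|]; exact: HA.
rewrite evU -setIA big_setU1 //= -muleA -IH => [||j jA]; last 2 first.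
- exact: mB.
- by apply: disM; exact: AU.
apply: (@rects_extend (J k)); last exact: sF.
  apply: measurableI; last exact: measurable_rect.
  by apply: mev => j jA; apply: sF; exact: AU.
move=> _ [B' mB' ->].
(* One family of sides for both rectangles, as their index sets are disjoint. *)
pose B2 i := if i \in J k then B' i else B i.
have mB2 i : measurable (B2 i) by rewrite /B2; case: ifP.
have dkM : [disjoint J k & M]%B by exact: disM.
have r1 : rect (J k) B' = rect (J k) B2.
  by apply/seteqP; split => w /= H i iJ; have := H i iJ; rewrite /B2 iJ.
have r2 : rect M B = rect M B2.
  apply/seteqP; split => w /= H i iM; have := H i iM; rewrite /B2; case: ifPn => // iJ;
  by move/pred0P: dkM => /(_ i) /=; rewrite iJ iM.
have r3 : rect (J k) B2 `&` rect M B2 = rect (J k :|: M)%SET B2.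
  apply/seteqP; split => w /=.
    by move=> [H1 H2] i; rewrite !inE => /orP[]; [exact: H1|exact: H2].
  by move=> H; split => i iJ; apply: H; rewrite !inE iJ ?orbT.
have dAM j : j \in A -> [disjoint J j & M]%B by move=> jA; apply: disM; exact: AU.
rewrite setICA r1 r2 r3 !IH //.
  by rewrite rect_indep // muleCA.
move=> j jA; apply/pred0P => i /=; rewrite finset.in_setU andb_orr.
have /pred0P/(_ i) /= -> : [disjoint J j & J k]%B.
  by apply: dis => //; [exact: AU|apply: contraNneq kA => <-].
by have /pred0P/(_ i) /= -> := dAM j jA.
Qed.

End Independence.

(** * Sites with a strong influence of the boundary *)

Section Measurability.
Context (R : realType) (dT : measure_display) (T : measurableType dT).

Lemma measurable_sum_cond (I : finType) (Q : pred I) (F : I -> T -> R) :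
  (forall i, measurable_fun setT (F i)) ->
  measurable_fun setT (fun x => \sum_(i | Q i) F i x).
Proof.
move=> mF.
have -> : (fun x => \sum_(i | Q i) F i x) =
    (fun x => \sum_(i <- [seq i <- index_enum I | Q i]) F i x).
  by apply/funext => x; rewrite big_filter.
exact: measurable_sum.
Qed.

Lemma measurable_isingW (V : finType) (J : V -> V -> R) (g : V -> T -> R) s :
  (forall u, measurable_fun setT (g u)) ->
  measurable_fun setT (fun x => isingW J (fun u => g u x) s).
Proof.
move=> mg; rewrite /isingW; apply: measurableT_comp => //.
rewrite /energy; apply: measurable_realfun.measurable_funD => //.
apply: measurable_sum_cond => u; apply: measurable_realfun.measurable_funM => //.
Qed.

Lemma measurable_condE (V : finType) (J : V -> V -> R) (g : V -> T -> R) A f s :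
  (forall u, measurable_fun setT (g u)) ->
  measurable_fun setT (fun x => condE (isingW J (fun u => g u x)) A f s).
Proof.
move=> mg.
have Zp x := partf_gt0 (isingW_gt0 J (fun u => g u x)) A s.
have -> : (fun x => condE (isingW J (fun u => g u x)) A f s) =
  (fun x => (\sum_(t | agree A s t) isingW J (fun u => g u x) t * f t) *
     expR (- ln (partf (isingW J (fun u => g u x)) A s))).
  apply/funext => x; by rewrite expRN lnK // posrE.
apply: measurable_realfun.measurable_funM.
  apply: measurable_sum_cond => t; apply: measurable_realfun.measurable_funM => //.
  exact: measurable_isingW.
apply: measurableT_comp => //; apply: measurableT_comp => //.
apply: measurableT_comp => //; apply: measurable_sum_cond => t.
exact: measurable_isingW.
Qed.

Lemma measurable_bcgap (d : nat) (L : {fset 'rV[int]_d}) (beta : R) (g : L -> T -> R)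
    (A : {set L}) (o : L) : o \in A ->
  (forall u, measurable_fun setT (g u)) ->
  measurable_fun setT (fun x => bcgap beta (fun u => g u x) A o).
Proof.
move=> oA mg; under eq_fun do rewrite bcgapE //.
apply: measurableT_comp => //; apply: measurable_realfun.measurable_funB; exact: measurable_condE.
Qed.

End Measurability.

Section BadSites.
Context (R : realType) (disp : measure_display) (T : measurableType disp)
  (P : probability T R) (d : nat) (L : {fset 'rV[int]_d}) (h : L -> {RV P >-> R})
  (beta : R).
Implicit Types (A : {set L}) (o : L).

Definition bad_event (c : R) A o : set T :=
  [set w | c <= bcgap beta (fun u => h u w) A o].

(** The fields outside [A] may be replaced by zero without changing the gap. *)
Lemma bad_event_rects (c : R) A o : o \in A -> (<<s rects h A >> (bad_event c A o))%classic.
Proof.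
move=> oA.
pose T' := g_sigma_algebraType (rects h A).
pose g (u : L) (w : T') : R := if u \in A then h u w else 0.
have mg u : measurable_fun setT (g u).
  rewrite /g; case uA: (u \in A); last exact: measurable_cst.
  move=> _ B mB; rewrite [X in measurable X]setTI. apply: sub_sigma_algebra.
  exists (fun i => if i == u then B else setT) => [i|]; first by case: ifP.
  apply/seteqP; split => w /= => [Bw i iA|/(_ u uA)]; last by rewrite eqxx.
  by case: eqP => // ->.
have mb := measurable_bcgap beta oA mg.
have -> : (bad_event c A o = (fun w : T' => bcgap beta (fun u => g u w) A o) @^-1` `[c, +oo[)%classic.
  have gE w : bcgap beta (fun u => g u w) A o = bcgap beta (fun u => h u w) A o.
    rewrite !bcgapE //; congr (`|_ - _|); apply: condE_field => u uA;
    by rewrite /g uA.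
  by apply/seteqP; split => w; rewrite set_itvE /bad_event /= (gE w).
have := mb measurableT _ (measurable_itv `[c, +oo[); rewrite setTI; exact.
Qed.

Lemma measurable_bad_event (c : R) A o : o \in A -> measurable (bad_event c A o).
Proof. by move=> oA; exact: rects_measurable (bad_event_rects c oA). Qed.

(** Markov's inequality. *)
Lemma bad_event_le (c : R) A o (M : R) : 0 < c -> o \in A ->
  ('E_P[fun w => bcgap beta (fun u => h u w) A o] <= M%:E)%E ->
  (P (bad_event c A o) <= (M / c)%:E)%E.
Proof.
move=> c0 oA; rewrite unlock => EM.
have mb : measurable_fun setT (fun w => bcgap beta (fun u => h u w) A o).
  by apply: measurable_bcgap => // u; exact: measurable_funP.
set f := fun w => bcgap beta (fun u => h u w) A o in EM mb.
have mEb : measurable_fun [set: T]%classic (fun w => (f w)%:E) by exact/measurable_EFinP.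
have f0 w : 0 <= f w by exact: bcgap_ge0.
have H := @le_integral_comp_abse _ _ _ P _ measurableT
  (fun w => (f w)%:E) c id (@measurable_id _ _ _)
  (fun r r0 => r0) (fun x y _ _ xy => xy) mEb c0.
have {}H : (c%:E * P (bad_event c A o) <= M%:E)%E.
  apply: le_trans EM; move: H; rewrite setTI.
  rewrite (_ : [set x | _]%classic = bad_event c A o); last first.
    by apply/seteqP; split => w /=; rewrite lee_fin ger0_norm.
  move=> /le_trans; apply; rewrite le_eqVlt; apply/orP; left; apply/eqP.
  by apply: eq_integral => w _; rewrite /= ger0_norm.
have PE : (P (bad_event c A o) = (fine (P (bad_event c A o)))%:E)%E.
  by rewrite fineK // fin_num_measure //; exact: measurable_bad_event.
move: H; rewrite PE -EFinM !lee_fin => H.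
by rewrite ler_pdivlMr // mulrC.
Qed.
End BadSites.

(** * Percolation of bad cells *)

Section UnionBound.
Context (R : realType) (disp : measure_display) (T : measurableType disp)
  (P : probability T R).

Lemma exists_bigsetU (I : finType) (Q : pred I) (F : I -> set T) :
  [set w | exists2 i, Q i & F i w]%classic = (\big[setU/set0]_(i | Q i) F i)%classic.
Proof.
apply/seteqP; split => [w /= [i Qi Fi]|w].
  by rewrite (bigD1 i) //=; left.
by elim/big_rec: _ => [[]//|i A Qi IH [Fi|/IH//]]; exists i.
Qed.

Lemma measurable_exists (I : finType) (Q : pred I) (F : I -> set T) :
  (forall i, Q i -> measurable (F i)) -> measurable [set w | exists2 i, Q i & F i w]%classic.
Proof. by move=> mF; rewrite exists_bigsetU; apply: bigsetU_measurable. Qed.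

Lemma prob_exists_le (I : finType) (Q : pred I) (F : I -> set T) (p : I -> R) :
  (forall i, Q i -> measurable (F i)) -> (forall i, Q i -> (P (F i) <= (p i)%:E)%E) ->
  (P [set w | exists2 i, Q i & F i w]%classic <= (\sum_(i | Q i) p i)%:E)%E.
Proof.
move=> mF Fp; rewrite exists_bigsetU.
suff [] : (measurable (\big[setU/set0]_(i | Q i) F i)%classic /\
  P (\big[setU/set0]_(i | Q i) F i)%classic <= (\sum_(i | Q i) p i)%:E)%E by [].
elim/big_rec2: _ => [|i x A Qi [mA IH]]; first by rewrite measure0; split.
split; first by apply: measurableU => //; exact: mF.
apply: le_trans (measureU2 _ _ _) _ => //; first exact: mF.
by rewrite EFinD leeD // Fp.
Qed.

End UnionBound.

Section Cells.
Variables (d : nat) (L : {fset 'rV[int]_d}) (s : nat).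
Hypothesis s_gt0 : (0 < s)%N.
Implicit Types (x y : L).

Definition cells : {fset 'rV[int]_d} := [fset shifted_cell s 0 x | x in L]%fset.

Lemma cell_in x : shifted_cell s 0 (val x) \in cells.
Proof. by apply/imfsetP; exists (val x) => //; exact: valP. Qed.

Definition cell_of x : cells := [` cell_in x]%fset.

Lemma cell_ofE x i : (val (cell_of x)) 0 i = divz ((val x) 0 i) s%:Z.
Proof. by rewrite /cell_of /= mxE addr0. Qed.

Lemma cell_bounds x i :
  (val (cell_of x)) 0 i * s%:Z <= (val x) 0 i < (val (cell_of x)) 0 i * s%:Z + s%:Z.
Proof.
rewrite cell_ofE.
have gz : s%:Z != 0 by lia.
have := divz_eq ((val x) 0 i) s%:Z; have := modz_ge0 ((val x) 0 i) gz.
have := @ltz_pmod ((val x) 0 i) s%:Z.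
by move: (_ %/ _)%Z (_ %% _)%Z => q r; lia.
Qed.

Definition sites_in (k : cells) : {set L} := [set x | cell_of x == k].

Lemma card_sites_in k : (#|sites_in k| <= s ^ d)%N.
Proof.
apply: (@card_box_le _ _ _ (fun i => (val k) 0 i * s%:Z)) => // x.
rewrite inE => /eqP <- i; exact: cell_bounds.
Qed.

Lemma card_cells : (#|{: cells}| <= #|{: L}|)%N.
Proof.
have sub : [set: cells] \subset [set cell_of x | x : L].
  apply/fintype.subsetP => k _; have /imfsetP[x /= xL kE] := valP k.
  by apply/imsetP; exists [` xL]%fset => //; apply: val_inj; rewrite /= kE.
by rewrite -cardsT (leq_trans (subset_leq_card sub)) // (leq_trans (leq_imset_card _ _)) // cardsT.
Qed.

Lemma near_cells x y : near1 x y -> near1 (cell_of x) (cell_of y).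
Proof.
move=> /forallP xy; apply/forallP => i.
have := xy i; have := cell_bounds x i; have := cell_bounds y i.
move: ((val (cell_of x)) 0 i) ((val (cell_of y)) 0 i) => p q.
move: ((val x) 0 i) ((val y) 0 i) => u v H1 H2 H3.
have : q + 2 <= p \/ p + 2 <= q \/ `|p - q| <= 1 by lia.
by case=> [?|[?|//]]; exfalso; nia.
Qed.

(** The sites whose fields decide whether the cell [k] is bad. *)
Definition reach (k : cells) : {set L} := \bigcup_(x in sites_in k) box x s.

(** Cells of equal colour differ by at least [3] in some coordinate, so that
    neighbourhoods of width [s] around them do not meet. *)
Definition colour (k : cells) : {ffun 'I_d -> 'I_3} :=
  [ffun i => inord (absz (modz ((val k) 0 i) 3))].

Lemma card_colour : #|{: {ffun 'I_d -> 'I_3}}| = (3 ^ d)%N.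
Proof. by rewrite card_ffun !card_ord. Qed.

Lemma reach_disjoint k k' : colour k = colour k' -> k != k' -> [disjoint reach k & reach k'].
Proof.
move=> ck kk'; have [i ki] : exists i, (val k) 0 i != (val k') 0 i.
  apply/existsP; rewrite -negb_forall; apply: contra kk' => /forallP H.
  by apply/eqP/val_inj/rowP => i; apply/eqP/H.
have cki : modz ((val k) 0 i) 3 = modz ((val k') 0 i) 3.
  move/ffunP: ck => /(_ i); rewrite !ffunE => /(congr1 val).
  by rewrite /= !inordK; lia.
apply/pred0P => z /=; apply/negP => /andP[/bigcupP[x xk zx] /bigcupP[y yk zy]].
move: xk zx yk zy; rewrite !inE => /eqP xk /forallP/(_ i) zx /eqP yk /forallP/(_ i) zy.
have := cell_bounds x i; have := cell_bounds y i; rewrite xk yk.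
move: zx zy ki cki.
move: ((val k) 0 i) ((val k') 0 i) ((val x) 0 i) ((val y) 0 i) ((val z) 0 i).
move=> p q a b c; move=> H1 H2 H3 H4 H5 H6.
have : p - q >= 3 \/ q - p >= 3 by lia.
by case=> ?; nia.
Qed.

End Cells.

Section LargeClusters.
Context (R : realType) (disp : measure_display) (T : measurableType disp)
  (P : probability T R) (d : nat) (L : {fset 'rV[int]_d}) (h : L -> {RV P >-> R})
  (beta : R).
Hypothesis indep : mutually_independent h.
Variables (s : nat) (c q0 : R).
Hypothesis s_gt0 : (0 < s)%N.
Hypothesis bad_le : forall x : L, (P (bad_event h beta c (box x s) x) <= q0%:E)%E.
Hypothesis q0_ge0 : 0 <= q0.

Local Notation K := (cells L s).

Lemma box_center (x : L) r : x \in box x r.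
Proof. by rewrite inE; apply/forallP => i; rewrite subrr normr0. Qed.

Definition bad_cell (k : K) : set T :=
  [set w | exists2 x, x \in sites_in k & bad_event h beta c (box x s) x w]%classic.

Lemma rects_sub (A A' : {set L}) : A \subset A' -> (rects h A `<=` rects h A')%classic.
Proof.
move=> /fintype.subsetP AA' _ [B mB ->].
exists (fun i => if i \in A then B i else setT) => [i|]; first by case: ifP.
apply/seteqP; split => w /= H i iA; last by have := H i (AA' _ iA); rewrite iA.
by case: ifPn => // iA'; exact: H.
Qed.

Lemma bad_cell_rects k : (<<s rects h (reach k) >> (bad_cell k))%classic.
Proof.
have := @measurable_exists _ (g_sigma_algebraType (rects h (reach k))) L
  (mem (sites_in k)) (fun x => bad_event h beta c (box x s) x); apply.
move=> x xk.
have sub : box x s \subset reach k.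
  by apply/fintype.subsetP => y yx; apply/bigcupP; exists x.
by apply: (sub_sigma_algebra2 (rects_sub sub)); exact: bad_event_rects (box_center x s).
Qed.

Lemma measurable_bad_cell k : measurable (bad_cell k).
Proof. exact: rects_measurable (@bad_cell_rects k). Qed.

Lemma bad_cell_le k : (P (bad_cell k) <= ((s ^ d)%:R * q0)%:E)%E.
Proof.
have mF (x : L) : x \in sites_in k -> measurable (bad_event h beta c (box x s) x).
  by move=> _; apply: measurable_bad_event; exact: box_center.
apply: le_trans (prob_exists_le mF (fun x _ => bad_le x)) _.
rewrite lee_fin sumr_const -[leLHS]mulr_natl ler_wpM2r // ler_nat.
exact: card_sites_in.
Qed.

(** The cells of [A] of the most frequent colour are a fraction at least [3^-d] of
    [A], and their badness is decided by disjoint groups of fields. *)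
Lemma all_bad_le (A : {set K}) (eta : R) : 0 <= eta -> eta <= 1 ->
  (s ^ d)%:R * q0 <= eta ^+ (3 ^ d) ->
  (P [set w | forall k, k \in A -> bad_cell k w]%classic <= (eta ^+ #|A|)%:E)%E.
Proof.
move=> e0 e1 Hq.
have [->|A0] := eqVneq A finset.set0.
  by rewrite cards0 expr0; apply: probability_le1; have -> :
    [set w | forall k, k \in finset.set0 -> bad_cell k w]%classic = setT;
    [apply/seteqP; split => // w _ k; rewrite inE|exact: measurableT].
have [col Hcol] := pigeonhole_colour (@colour d L s) A0.
set A' := [set k in A | colour k == col] in Hcol.
have mall (B : {set K}) : measurable [set w | forall k, k \in B -> bad_cell k w]%classic.
  have -> : [set w | forall k, k \in B -> bad_cell k w]%classic =
      (\bigcap_(k in [set k | k \in B]) bad_cell k)%classic.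
    by apply/seteqP; split => w /= H k /H.
  by apply: fin_bigcap_measurable => // k _; exact: measurable_bad_cell.
apply: (@le_trans _ _ (P [set w | forall k, k \in A' -> bad_cell k w]%classic)).
  apply: le_measure; rewrite ?inE //.
  by move=> w /= H k; rewrite inE => /andP[kA _]; exact: H.
rewrite (indep_groups indep (J := @reach d L s) (F := bad_cell)); last 2 first.
- move=> k k'; rewrite !inE => /andP[_ /eqP kc] /andP[_ /eqP k'c] kk'.
  by apply: (reach_disjoint s_gt0) => //; rewrite kc.
- by move=> k _; exact: bad_cell_rects.
pose p k := fine (P (bad_cell k)).
have pE k : P (bad_cell k) = (p k)%:E.
  by rewrite /p fineK // fin_num_measure //; exact: measurable_bad_cell.
have p0 k : 0 <= p k by rewrite fine_ge0.
have pq k : p k <= eta ^+ (3 ^ d).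
  by apply: le_trans Hq; rewrite -lee_fin -pE; exact: bad_cell_le.
under eq_bigr do rewrite pE.
rewrite prodEFin lee_fin.
apply: (@le_trans _ _ (\prod_(k in A') eta ^+ (3 ^ d))).
  by apply: ler_prod => k _; rewrite p0 pq.
rewrite prodr_const -exprM; apply: ler_wiXn2l => //.
by move: Hcol; rewrite card_colour.
Qed.

Definition bad_cells (w : T) : {set K} := [set k | `[< bad_cell k w >]].

Definition small_clumps (n : nat) : set T :=
  [set w | forall k, k \in bad_cells w ->
     (#|clump (@near1 d K) (bad_cells w) k| <= n)%N]%classic.

(** Peierls' argument: a given animal of [m] cells is bad with probability at most
    [2^-((3^d + 1) m)] times [exp(-m)]; the first factors have sum at most [1] over
    the animals containing a given cell. *)
Lemma small_clumps_prob (n : nat) :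
  (s ^ d)%:R * q0 <= ((2^-1) ^+ (3 ^ d).+1 * expR (-1)) ^+ (3 ^ d) ->
  exists G : set T, [/\ measurable G, (G `<=` small_clumps n)%classic &
    (1 - (#|{: L}|%:R * expR (- n%:R)))%:E <= P G]%E.
Proof.
set eta : R := (2^-1) ^+ (3 ^ d).+1 * expR (-1) => Hq.
have e0 : 0 <= eta by rewrite mulr_ge0 ?expR_ge0 // exprn_ge0.
have e1 : eta <= 1.
  apply: mulr_ile1; rewrite ?expR_ge0 ?exprn_ge0 //.
    by rewrite exprn_ile1 ?invr_ge0 // invf_le1 // ler1n.
pose Q (kA : K * {set K}) := (clump (@near1 d K) kA.2 kA.1 == kA.2) && (n < #|kA.2|)%N.
pose F (kA : K * {set K}) := [set w | forall k, k \in kA.2 -> bad_cell k w]%classic.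
have mF kA : Q kA -> measurable (F kA).
  move=> _; have -> : F kA = (\bigcap_(k in [set k | k \in kA.2]) bad_cell k)%classic.
    by apply/seteqP; split => w /= H k /H.
  by apply: fin_bigcap_measurable => // k _; exact: measurable_bad_cell.
pose B := [set w | exists2 kA, Q kA & F kA w]%classic.
have mB : measurable B by exact: measurable_exists.
have PB : (P B <= (#|{: L}|%:R * expR (- n%:R))%:E)%E.
  apply: le_trans (prob_exists_le mF (fun kA _ => all_bad_le kA.2 e0 e1 Hq)) _.
  rewrite lee_fin.
  rewrite -(pair_big_dep xpredT (fun k A => Q (k, A)) (fun k A => eta ^+ #|A|)) /=.
  apply: (@le_trans _ _ (\sum_(k : K) expR (- n%:R))); last first.
    by rewrite sumr_const -[leLHS]mulr_natl ler_wpM2r ?expR_ge0 // ler_nat card_cells.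
  apply: ler_sum => k _; rewrite /Q /=.
  rewrite -[leRHS]mul1r.
  have deg k' : (#|[set j | @near1 d K k' j]| <= 3 ^ d)%N.
    by apply: (@card_near1 _ _ k') => j; rewrite inE.
  apply: le_trans (ler_wpM2r (expR_ge0 _) (sum_animals deg R k)).
  rewrite mulr_suml big_mkcondr; apply: ler_sum => A _.
  case: ifPn => nA; last by rewrite mulr_ge0 ?expR_ge0 // exprn_ge0.
  rewrite /eta exprMn -exprM -expRM_natl ler_wpM2l ?exprn_ge0 //.
  by rewrite ler_expR mulrN1 lerN2 ler_nat ltnW.
exists (~` B)%classic; split.
- exact: measurableC.
- move=> w /= nB k kS; rewrite leqNgt; apply/negP => nC; apply: nB.
  exists (k, clump (@near1 d K) (bad_cells w) k); rewrite /Q /F /=.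
    by rewrite nC andbT; apply/eqP; exact: clump_idem.
  move=> j jC; have /fintype.subsetP/(_ j jC) := clump_sub (@near1 d K) kS.
  by rewrite inE => /asboolP.
- by rewrite probability_setC // EFinB leeB.
Qed.

End LargeClusters.

(** * The Poincaré inequality for a typical field *)

Section Assembly.
Context (R : realType) (disp : measure_display) (T : measurableType disp)
  (P : probability T R) (d : nat) (L : {fset 'rV[int]_d}) (h : L -> {RV P >-> R})
  (beta : R).
Variables (s : nat) (c : R).
Hypotheses (s_gt0 : (0 < s)%N) (d_gt0 : (0 < d)%N) (c_ge0 : 0 <= c) (beta_ge0 : 0 <= beta).

Local Notation K := (cells L s).
Local Notation n := (s ^ (d * d))%N.
Local Notation M := (d * 3 ^ d + 3 ^ d + 9 ^ d)%N.

Hypothesis c_small : c * (3 ^ d * (s.*2.+1) ^ d)%:R * (3 ^ d * (n * s ^ d))%:R <= 2^-1.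

(** The blocks are the box of radius [s] around a site of a good cell, and the
    union of the cells of its cluster around a site of a bad cell. Sites next to
    such a union lie in good cells, as otherwise their cell would have joined the
    cluster. *)
Lemma poincare_of_small_clumps (w : T) phi :
  small_clumps h beta s c n w ->
  pmf_var (rfim beta (fun u => h u w)) phi <=
  8 * #|{: L}|%:R * expR (beta * (M * n)%:R) * dirichlet (rfim beta (fun u => h u w)) phi.
Proof.
move=> small.
pose S := bad_cells h beta s c w.
pose good := [set v : L | cell_of s v \notin S].
pose clu v := clump (@near1 d K) S (cell_of s v).
pose blk v := if v \in good then box v s else [set x | cell_of s x \in clu v].
pose theta := c * (3 ^ d * (s.*2.+1) ^ d)%:R.
have n0 : (0 < n)%N by rewrite expn_gt0 s_gt0.
have card_clu v : v \notin good -> (#|blk v| <= n * s ^ d)%N.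
  move=> vb; rewrite /blk (negbTE vb).
  have vS : cell_of s v \in S by move: vb; rewrite inE negbK.
  have sub : [set x | cell_of s x \in clu v] \subset \bigcup_(k in clu v) sites_in k.
    apply/fintype.subsetP => x; rewrite inE => xk.
    by apply/bigcupP; exists (cell_of s x) => //; rewrite inE.
  apply: leq_trans (subset_leq_card sub) _; apply: leq_trans (card_bigcup_le _ _) _.
  apply: (@leq_trans (\sum_(k in clu v) s ^ d)).
    by apply: leq_sum => k _; exact: card_sites_in.
  by rewrite sum_nat_const leq_mul2r small ?orbT.
have card_good v : v \in good -> (#|ext_boundary (blk v)| <= 3 ^ d * (s.*2.+1) ^ d)%N.
  move=> vg; rewrite /blk vg; apply: leq_trans (card_ext_boundary _) _.
  by rewrite leq_mul2l card_box_center orbT.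
have theta0 : 0 <= theta by rewrite mulr_ge0.
apply: (@rfim_poincare _ _ _ beta _ blk good theta) => //.
- apply: le_trans c_small; rewrite -/theta -[leLHS]mulr1 ler_wpM2l // ler1n.
  by rewrite muln_gt0 expn_gt0 /= muln_gt0 n0 expn_gt0 s_gt0.
- move=> v; rewrite /blk; case: ifP => _; first exact: box_center.
  by rewrite inE; exact: clump_refl.
- move=> v vg; rewrite /theta; apply: ler_pM; rewrite ?bcgap_ge0 ?ler0n //.
    rewrite /blk vg leNgt; apply/negP => gap.
    move: vg; rewrite inE => /negP; apply; rewrite inE; apply/asboolP.
    by exists v; rewrite ?inE //; exact: ltW.
  by rewrite ler_nat card_good.
- move=> v vb; have vS : cell_of s v \in S by move: vb; rewrite inE negbK.
  rewrite /blk (negbTE vb); apply/fintype.subsetP => u; rewrite inE => /andP[uC].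
  move=> /existsP[x /andP[xC xu]]; rewrite !inE in uC xC.
  rewrite inE; apply: (@clump_outer _ (@near1 d K) S (cell_of s v)) => //.
  rewrite inE; apply/andP; split; first by rewrite /clu inE.
  apply/existsP; exists (cell_of s x); rewrite /clu [_ \in clump _ _ _]inE xC /=.
  by apply: near_cells => //; exact: lattice_adj_near1.
- move=> v vb; apply: le_trans c_small; rewrite -/theta ler_wpM2l // ler_nat.
  by apply: leq_trans (card_ext_boundary _) _; rewrite leq_mul2l card_clu ?orbT.
- move=> v f.
  set W := isingW _ _.
  have sub : \sum_(x in blk v) condD W [set x] f <= \sum_x condD W [set x] f.
    rewrite [leLHS]big_mkcond; apply: ler_sum => x _; case: ifP => // _.
    by apply: condD_ge0 => t; exact: isingW_gt0.
  have [vg|vb] := boolP (v \in good).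
    apply: le_trans (condD_single _ beta_ge0 _ _) _; apply: ler_pM => //.
    - by apply: sumr_ge0 => x _; apply: condD_ge0 => t; exact: isingW_gt0.
    - rewrite ler_expR ler_wpM2l // ler_nat /blk vg.
      apply: (@leq_trans (9 ^ d * n)); last by rewrite leq_mul2r leq_addl orbT.
      apply: (@leq_trans (3 ^ d * (3 * s) ^ d)).
        rewrite leq_mul2l; apply/orP; right; apply: leq_trans (card_box_center _ _) _.
        by rewrite leq_exp2r //; lia.
      rewrite expnMn mulnA -expnMn leq_mul2l; apply/orP; right.
      by rewrite leq_pexp2l // leq_pmulr.
  apply: le_trans (condD_block _ beta_ge0 _ (_ : 0 < s ^ d)%N (card_clu v vb)) _.
    by rewrite expn_gt0 s_gt0.
  apply: ler_pM => //.
  - by apply: sumr_ge0 => x _; apply: condD_ge0 => t; exact: isingW_gt0.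
  - by rewrite ler_expR ler_wpM2l // ler_nat -expnM -mulnDl leq_mul2r leq_addr orbT.
Qed.

End Assembly.

Lemma pow_expR_small (R : realType) (m : nat) (a e : R) : 0 < a -> 0 < e ->
  exists s0 : nat, (0 < s0)%N /\
    forall s : nat, (s0 <= s)%N -> (s ^ m)%:R * expR (- (a * s%:R)) <= e.
Proof.
move=> a0 e0.
pose b : R := a / m.+1%:R.
have b0 : 0 < b by rewrite divr_gt0.
have k0 : 0 < (b ^+ m.+1 * e)^-1 by rewrite invr_gt0 mulr_gt0 // exprn_gt0.
have := archi_boundP (ltW k0); set n0 := Num.bound _ => Hn.
exists n0.+1; split => // s ns.
have s0 : 0 < s%:R :> R by rewrite ltr0n (leq_trans _ ns).
have H : (b * s%:R) ^+ m.+1 <= expR (a * s%:R).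
  have -> : a * s%:R = m.+1%:R * (b * s%:R).
    by rewrite /b mulrA [_ * (a / _)]mulrC divfK ?pnatr_eq0.
  rewrite expRM_natl lerXn2r ?nnegrE ?expR_ge0 ?mulr_ge0 ?ltW //.
  by apply: lt_le_trans (expR_ge1Dx _); rewrite ltr_pwDl.
have se : 1 <= b ^+ m.+1 * s%:R * e.
  have : (b ^+ m.+1 * e)^-1 * 1 <= s%:R.
    by rewrite mulr1; apply: le_trans (ltW Hn) _; rewrite ler_nat (leq_trans _ ns).
  by rewrite ler_pdivrMl ?mulr_gt0 ?exprn_gt0 // mulrAC.
rewrite expRN ler_pdivrMr ?expR_gt0 //.
apply: le_trans (ler_wpM2l (ltW e0) H).
have -> : e * (b * s%:R) ^+ m.+1 = (b ^+ m.+1 * s%:R * e) * s%:R ^+ m.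
  by rewrite exprMn [s%:R ^+ m.+1]exprS; ring.
by rewrite natrX -[leLHS]mul1r ler_wpM2r // exprn_ge0 // ltW.
Qed.

(** A scale [m] with [m ^ D] between [x] and a multiple of [x]: quantities
    exponential in [m ^ D] are then powers of [exp x]. *)
Lemma exists_scale (R : realType) (D : nat) (x : R) : (0 < D)%N -> 0 <= x ->
  exists m : nat, x <= (m ^ D)%:R /\ (m ^ D)%:R <= 2 ^+ D * x + 1.
Proof.
move=> D0 x0.
have ex : exists m, x <= (m ^ D)%:R.
  have := archi_boundP x0; set m := Num.bound x => xm; exists m.
  apply: le_trans (ltW xm) _; rewrite ler_nat.
  by case: (m) => // m'; rewrite -[leqLHS]expn1 leq_pexp2l.
case: (ex_minnP ex) => m xm mmin; exists m; split => //.
case: m xm mmin => [|[|m]] xm mmin.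
- by rewrite exp0n // addr_ge0 // mulr_ge0 // exprn_ge0.
- by rewrite exp1n lerDr mulr_ge0 // exprn_ge0.
have mx : (m.+1 ^ D)%:R <= x.
  by rewrite leNgt; apply/negP => /ltW /mmin; rewrite ltnn.
apply: (@le_trans _ _ (2 ^+ D * x)); last by rewrite lerDl.
apply: (@le_trans _ _ ((2 * m.+1) ^ D)%:R).
  by rewrite ler_nat leq_exp2r //; lia.
by rewrite expnMn natrM natrX ler_wpM2l // exprn_ge0.
Qed.

(** Geometric mean of the two bounds on [V], with weights [1 / p] and [1 / q]. *)
Lemma interpolate (R : realType) (p q V B E O : R) :
  0 < p^-1 -> 0 < q^-1 -> p^-1 + q^-1 = 1 ->
  0 <= V -> 0 <= B -> 0 <= E -> 0 <= O -> V <= B * E -> V <= O ^+ 2 ->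
  V <= B `^ p^-1 * E `^ p^-1 * O `^ (2 / q).
Proof.
move=> p0 q0 pq V0 B0 E0 O0 VBE VO.
have -> : V = V `^ p^-1 * V `^ q^-1.
  by rewrite -powRD ?pq ?powRr1 // oner_eq0.
rewrite -powRM //; apply: ler_pM; rewrite ?powR_ge0 //.
  by apply: ge0_ler_powR; rewrite ?nnegrE ?mulr_ge0 // ltW.
rewrite powRrM powR_mulrn //.
by apply: ge0_ler_powR; rewrite ?nnegrE ?exprn_ge0 // ltW.
Qed.

Unset Implicit Arguments.
Local Open Scope classical_set_scope.

Theorem theorem3p3 (R : realType) (d : nat) (beta C : R)
    (hd : (2 <= d)%N) (hbeta : 0 < beta) (hC : 0 < C) :
  exists p q K kappa : R,
    [/\ 1 <= p, 1 <= q, p^-1 + q^-1 = 1, 0 < K & 0 < kappa] /\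
    forall (disp : measure_display) (T : measurableType disp)
      (P : probability T R) (L : {fset 'rV[int]_d}) (h : L -> {RV P >-> R}),
      iid_symmetric h ->
      WSM h beta C ->
      forall delta : R, 0 < delta -> delta < 1 ->
      exists G : set T,
        [/\ measurable G,
            ((1 - delta)%:E <= P G)%E
          & forall w : T, G w -> forall phi : config L -> R,
              let mu := rfim beta (fun u => h u w) in
              pmf_var mu phi <=
                K * delta `^ (- q^-1) * (#|` L |%fset%:R) `^ kappa
                * (dirichlet mu phi) `^ (p^-1) * (osc phi) `^ (2 / q)].
Proof.
have dbl k : (0 < k)%N -> (k.*2.+1 <= 3 * k)%N by lia.
have d0 : (0 < d)%N by exact: leq_trans hd.
pose D := (d * d)%N.
have D0 : (0 < D)%N by rewrite muln_gt0 d0.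
(* Half of the decay rate is spent on Markov's inequality. *)
pose a : R := (2 * C)^-1.
have a0 : 0 < a by rewrite invr_gt0 mulr_gt0.
pose eta : R := ((2^-1) ^+ (3 ^ d).+1 * expR (-1)) ^+ (3 ^ d).
have eta0 : 0 < eta by rewrite exprn_gt0 // mulr_gt0 ?expR_gt0 // exprn_gt0 // invr_gt0.
(* Scales from [s1] on make bad cells rare enough for the count of animals; from
   [s2] on the influence on good sites beats all block boundaries. *)
have [s1 [s1_gt0 Hs1]] := @pow_expR_small R d a (eta / C) a0 (divr_gt0 eta0 hC).
have e2 : 0 < (2 * (27 ^ d)%:R)^-1 :> R by rewrite invr_gt0 mulr_gt0 // ltr0n expn_gt0.
have [s2 [s2_gt0 Hs2]] := @pow_expR_small R (d + (D + d)) a _ a0 e2.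
pose s0 := maxn s1 s2.
pose M := (d * 3 ^ d + 3 ^ d + 9 ^ d)%N.
have M0 : (0 < M)%N by rewrite /M addn_gt0 expn_gt0 orbT.
pose bM : R := beta * M%:R.
have bM0 : 0 < bM by rewrite mulr_gt0 // ltr0n.
(* The factor [2 ^+ D] is the loss of [exists_scale] when rounding to a scale. *)
pose A1 := bM * 2 ^+ D.
have A10 : 0 < A1 by rewrite mulr_gt0 // exprn_gt0.
pose A0 := expR (bM * ((s0 ^ D)%:R + 1)).
pose p := A1 + 1; pose q := (A1 + 1) / A1.
have p0 : 0 < p by rewrite addr_gt0.
have q0 : 0 < q by rewrite divr_gt0.
pose K := (8 * A0) `^ p^-1.
have pq : p^-1 + q^-1 = 1.
  by rewrite /p /q invf_div -{1}[_^-1]mul1r -mulrDl addrC divff // gt_eqF.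
exists p, q, K, 1; split.
  split => //.
  - by rewrite /p lerDr ltW.
  - by rewrite /q ler_pdivlMr // mul1r lerDl.
  - by rewrite powR_gt0 // mulr_gt0 // expR_gt0.
move=> disp T P L h [indep _] wsm delta delta0 delta1.
pose N : R := #|{: L}|%:R.
have N0 : 0 <= N by exact: ler0n.
pose x := ln (N / delta).
have Npos_ge1 : 0 < N -> 1 <= N by rewrite /N ltr0n ler1n.
have x0 : 0 <= x.
  rewrite /x; have [N1|] := ltP 0 N; last first.
    by move=> Nn; have -> : N = 0; [apply/le_anti; rewrite Nn N0|rewrite mul0r ln0].
  by rewrite ln_ge0 // ler_pdivlMr // mul1r (le_trans (ltW delta1)) // Npos_ge1.
have [m [xm mx]] := exists_scale D0 x0.
pose s := maxn s0 m.
have s1s : (s1 <= s)%N by rewrite /s /s0 !leq_max leqnn.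
have s2s : (s2 <= s)%N by rewrite /s /s0 !leq_max leqnn !orbT.
have s_gt0 : (0 < s)%N by exact: leq_trans s1s.
have xs : x <= (s ^ D)%:R.
  by apply: le_trans xm _; rewrite ler_nat leq_exp2r // leq_maxr.
have sx : (s ^ D)%:R <= (s0 ^ D)%:R + 1 + 2 ^+ D * x :> R.
  rewrite /s; have [_|_] := leqP s0 m; first by have : 0 <= (s0 ^ D)%:R :> R by []; lra.
  have : 0 <= 2 ^+ D * x by rewrite mulr_ge0 // exprn_ge0.
  lra.
have xE : 0 < N -> expR x = N / delta by move=> Np; rewrite /x lnK // posrE divr_gt0.
pose c := expR (- (a * s%:R)).
have c0 : 0 < c by exact: expR_gt0.
have q0_ge0 : 0 <= C * c by rewrite mulr_ge0 // ltW.
have bad_le (o : L) : (P (bad_event h beta c (box o s) o) <= (C * c)%:E)%E.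
  have -> : C * c = C * expR (- (s%:R / C)) / c.
    rewrite -mulrA; congr (_ * _); rewrite /c -expRN -expRD; congr expR.
    by rewrite /a; field; rewrite gt_eqF.
  by apply: bad_event_le => //; [exact: box_center|exact: wsm].
have Hq : (s ^ d)%:R * (C * c) <= eta.
  by rewrite mulrCA mulrC -ler_pdivlMr // Hs1.
have [G [mG Gsmall PG]] := small_clumps_prob indep s_gt0 bad_le q0_ge0 (s ^ D) Hq.
exists G; split => //.
  apply: le_trans PG; rewrite lee_fin lerD2l lerN2.
  have [Np|Nn] := ltP 0 N; last first.
    by rewrite -/N (_ : N = 0) ?mul0r ?ltW //; apply/le_anti; rewrite Nn N0.
  rewrite -/N mulrC -ler_pdivlMr // -[leRHS]invf_div -xE // -expRN ler_expR lerN2 //.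
move=> w Gw phi; cbv zeta; set mu := rfim _ _.
have c_small : c * (3 ^ d * (s.*2.+1) ^ d)%:R * (3 ^ d * (s ^ (d * d) * s ^ d))%:R <= 2^-1.
  have := Hs2 s s2s; rewrite -/c => H2.
  have -> : 2^-1 = (27 ^ d)%:R * (2 * (27 ^ d)%:R)^-1 :> R.
    by field; rewrite pnatr_eq0 expn_eq0.
  apply: le_trans (ler_wpM2l (ler0n _ _) H2).
  rewrite [leRHS]mulrA -!natrM -mulrA -natrM [leLHS]mulrC.
  apply: (ler_wpM2r (ltW c0)); rewrite ler_nat.
  rewrite !expnD -/D.
  have E27 : (27 ^ d = 3 ^ d * 3 ^ d * 3 ^ d)%N by rewrite -!expnMn.
  have H3 : (s.*2.+1 ^ d <= 3 ^ d * s ^ d)%N by rewrite -expnMn leq_exp2r // dbl.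
  rewrite E27; move: H3; move: (s.*2.+1 ^ d)%N (3 ^ d)%N (s ^ d)%N (s ^ D)%N => X Y Z U H3.
  apply: (@leq_trans (Y * (Y * Z) * (Y * (U * Z)))).
    by rewrite leq_mul2r leq_mul2l H3 !orbT.
  by rewrite leq_eqVlt; apply/orP; left; apply/eqP; ring.
have PI := poincare_of_small_clumps s_gt0 d0 (ltW c0) (ltW hbeta) c_small phi (Gsmall _ Gw).
rewrite -/mu in PI.
have o0 : 0 <= osc phi.
  by have := osc_ge phi (all_spins L true) (all_spins L true); rewrite subrr.
have V0 : 0 <= pmf_var mu phi.
  by rewrite pmf_varE; apply: sumr_ge0 => t _; rewrite mulr_ge0 ?sqr_ge0 // rfim_ge0.
have E0 : 0 <= dirichlet mu phi.
  rewrite dirichletE; apply: divr_ge0; last exact: ltW (Ztot_gt0 _ _).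
  apply: sumr_ge0 => u _.
  by apply: condD_ge0 => t; exact: isingW_gt0.
pose B := 8 * A0 * (N * (N / delta) `^ A1).
have B0 : 0 <= B by rewrite !mulr_ge0 ?expR_ge0 ?powR_ge0.
have VB : pmf_var mu phi <= B * dirichlet mu phi.
  apply: le_trans PI _; rewrite ler_wpM2r // -/N /B -!mulrA ler_wpM2l //.
  have [Np|Nn] := ltP 0 N; last first.
    by rewrite (_ : N = 0) ?mul0r ?mulr0 //; apply/le_anti; rewrite Nn N0.
  rewrite mulrCA ler_wpM2l // /powR gt_eqF ?divr_gt0 // /A0 -expRD ler_expR.
  rewrite natrM mulrA -/M -/bM -/D -/x /A1 -mulrA -mulrDr ler_wpM2l // ltW //.
have KE : B `^ p^-1 = K * delta `^ (- q^-1) * N `^ 1.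
  rewrite /B powRM ?mulr_ge0 ?expR_ge0 ?powR_ge0 // -/K -mulrA; congr (_ * _).
  have dE : (N / delta) `^ A1 = N `^ A1 * delta `^ (- A1).
    rewrite powRM ?invr_ge0 ?(ltW delta0) //; congr (_ * _).
    by rewrite -powR_inv1 ?(ltW delta0) // -powRrM mulN1r.
  have NE : N * N `^ A1 = N `^ p.
    by rewrite /p powRD ?powRr1 1?mulrC // (gt_eqF p0).
  have -> : - q^-1 = - A1 * p^-1 by rewrite /q /p invf_div mulNr.
  rewrite dE mulrA NE powRM ?powR_ge0 // -!powRrM divff ?gt_eqF // mulrC //.
rewrite cardfE -/N -KE.
apply: interpolate => //; rewrite ?invr_gt0 //; exact: pmf_var_osc.
Qed.
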